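(* Let $D$ be a Dirichlet–Ferguson process with parameter $\alpha$ on $(A,\mathcal{A})$ with associated Pólya sequence $\mathbf{X}$. Suppose that $F\in L^2(D)$ admits the decomposition $$F=\mathbb{E}(F)+\sum_{n\ge1}\int_{A^n}h_{(F,n)}\,\mathrm{d}D^{\otimes n}\quad\text{(convergence in }L^2(\mathbb{P})),$$ where $h_{(F,n)}\in\Xi_n(\mathbf{X})$ for every $n\geq 1$. Then, for every $n\ge1$, the function $h_{(F,n)}$ satisfies $$h_{(F,n)}(a_1,\ldots,a_n)=\sum_{k=1}^n\theta^{(n,k)}\sum_{1\le j_1<\cdots<j_k\le n}\mathbb{E}\bigl(F-\mathbb{E}(F)\mid X_1=a_{j_1},\ldots,X_k=a_{j_k}\bigr)$$ for all $(a_1,\ldots,a_n)\in A^n$ outside a set of measure zero with respect to the probability induced on $A^n$ by the vector $\mathbf{X}_n=(X_1,\ldots,X_n)$.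
   Context: $(A,\mathcal{A})$ is a Polish space with its Borel $\sigma$-field and $\alpha$ is a finite positive measure on it ($0<\alpha(A)<\infty$). On a probability space $(\Omega,\mathcal{F},\mathbb{P})$, the Pólya sequence $\mathbf{X}=\{X_n:n\ge1\}$ with parameter $\alpha$ is a sequence of $A$-valued random variables such that, for every $k\ge1$ and $1\le j_1<\cdots<j_k$, $$\mathbb{P}(X_{j_1}\in da_1,\ldots,X_{j_k}\in da_k)=\prod_{i=1}^k\frac{\alpha(da_i)+\sum_{l=1}^{i-1}\delta_{a_l}(da_i)}{\alpha(A)+i-1}.$$ A Dirichlet–Ferguson process with parameter $\alpha$ is a random probability measure $D$ on $(A,\mathcal{A})$ such that for every finite measurable partition $(C_1,\ldots,C_n)$ of $A$ the vector $(D(C_1),\ldots,D(C_n))$ has a Dirichlet distribution with parameters $(\alpha(C_1),\ldots,\alpha(C_n))$. Standing convention: $D$ is the a.s. limit of the empirical measures $\frac1n\sum_{i=1}^n\mathbf{1}_C(X_i)$ of $\mathbf{X}$ (a.s. convergence for all $C\in\mathcal{A}$); then, conditionally on $D$, the $X_i$ are i.i.d. with law $D$. $L^2(D)$ is the space of square-integrable random variables measurable with respect to $\sigma(D(C):C\in\mathcal{A})$; $D^{\otimes n}$ is the $n$-fold random product measure. $\Xi_n(\mathbf{X})$ is the class of symmetric measurable $h:A^n\to\mathbb{R}$ with $\mathbb{E}(h(\mathbf{X}_n)^2)<\infty$ and $\mathbb{E}(h(\mathbf{X}_n)\mid\mathbf{X}_{n-1})=0$ a.s. (for $n=1$: $\mathbb{E}(h(X_1))=0$).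 Coefficients $\theta^{(k,a)}$. Conventions: $(a)_{(b)}=a!/b!$ for integers $a\ge b\ge 0$, empty products equal $1$, $\binom{a}{b}_*=\binom ab\mathbf{1}_{(a\ge b)}$. For $1\le m\le n$, $0\le r\le m$, $0\le p\le m-r$, $$\Phi(n,m,r,p)=(m-r)_{(m-r-p)}\frac{\prod_{s=1}^{m-(r+p)}[\alpha(A)+r+p+s-1]}{\prod_{s=1}^{m-r}[\alpha(A)+n+s-1]},$$ and for $1\le q\le m\le n\le N$, $$\Psi_N(q,n,m)=\sum_{r=0}^q\binom qr\binom{N-n}{m-r}_*\Phi(n,m,r,q-r).$$ For each $N\ge1$, the reals $\theta_N^{(k,a)}$ ($1\le a\le k\le N$) are defined recursively as follows: for $k=1,\ldots,N-1$, $\theta_N^{(k,k)}=\Psi_N(k,k,k)^{-1}$ and $\sum_{i=q}^k\sum_{j=q}^i\theta_N^{(i,j)}\Psi_N(q,k,j)=0$ for $q=1,\ldots,k-1$; moreover $\theta_N^{(N,a)}=-\sum_{s=a}^{N-1}\theta_N^{(s,a)}$ for $a=1,\ldots,N-1$ and $\theta_N^{(N,N)}=1$. Put $\theta_{N*}^{(k,a)}=\theta_N^{(k,a)}\binom{N-a}{k-a}^{-1}$. Finally, for $k\ge1$ and $1\le a\le k$, $\theta^{(k,a)}=\lim_{N\to+\infty}\binom Nk\theta_{N*}^{(k,a)}$ (the limit exists). *)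

(* Defs.v *)
From HB Require Import structures.
From mathcomp Require Import all_boot all_order all_algebra perm.
From mathcomp Require Import all_classical all_reals all_analysis measurable_realfun.

Set Implicit Arguments.
Unset Strict Implicit.
Unset Printing Implicit Defensive.

Import Order.TTheory GRing.Theory Num.Theory.
Import numFieldNormedType.Exports.

Local Open Scope classical_set_scope.
Local Open Scope ring_scope.

Definition polish (R : realType) (T : topologicalType) : Prop :=
  (exists2 S : set T, countable S & dense S) /\
  exists m : T -> T -> R,
    [/\ forall x y, m x y = 0 <-> x = y,
        forall x y, m x y = m y x,
        forall x y z, m x z <= m x y + m y z,
        forall x, nbhs x = filter_from [set e : R | 0 < e]
                                       (fun e => [set y | m x y < e])
      & forall u : nat -> T,
          (forall e : R, 0 < e -> exists N, forall i j, (N <= i)%N -> (N <= j)%N ->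
             m (u i) (u j) < e) ->
          exists x : T, u @ \oo --> x].

(* The sigma-field of [n.-tuple (borel A)] is the product one, which is the Borel
   sigma-field of A^n because a Polish space is second countable. *)
Notation borel A := (g_sigma_algebraType (@open A)).

Section product_probability.
Context {d} {T : measurableType d} {R : realType}.

Definition tuple_cons n (p : T * n.-tuple T) : n.+1.-tuple T :=
  [tuple of p.1 :: p.2].

Lemma measurable_tuple_cons n :
  measurable_fun [set: T * n.-tuple T] (@tuple_cons n).
Proof. exact: measurable_cons. Qed.

HB.instance Definition _ n :=
  isMeasurableFun.Build _ _ _ _ (@tuple_cons n) (@measurable_tuple_cons n).

Fixpoint prod_prob (n : nat) :
    ('I_n -> probability T R) -> probability (n.-tuple T) R :=
  match n return ('I_n -> probability T R) -> probability (n.-tuple T) R with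
  | 0 => fun=> \d_([tuple] : 0.-tuple T)
  | n'.+1 => fun mu =>
      distribution (mu ord0 \x prod_prob (fun i => mu (lift ord0 i)))%E
                   (@tuple_cons n')
  end.

Definition power_prob (mu : probability T R) (n : nat) :
  probability (n.-tuple T) R := prod_prob (fun _ : 'I_n => mu).

End product_probability.

Section dirichlet.
Context {R : realType}.

Definition gamma_weight (p : R) : R -> R :=
  (fun x => x `^ (p - 1) * expR (- x)) \_ `]0, +oo[.

Lemma gamma_weight_ge0 p x : 0 <= gamma_weight p x.
Proof.
by apply: restrict_ge0 => {}x _; rewrite mulr_ge0 ?powR_ge0 ?expR_ge0.
Qed.

Lemma measurable_gamma_weight p : measurable_fun [set: R] (gamma_weight p).
Proof.
apply/measurable_restrict => //; apply: measurable_funTS.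
apply: measurable_funM; first exact: measurable_powR.
exact: measurableT_comp.
Qed.

Definition gamma_weight_measure (p : R) (B : set R) : \bar R :=
  (\int[lebesgue_measure]_(x in B) (gamma_weight p x)%:E)%E.

Let gamma0 p : gamma_weight_measure p set0 = 0%E.
Proof. by rewrite /gamma_weight_measure integral_set0. Qed.

Let gamma_ge0 p B : (0 <= gamma_weight_measure p B)%E.
Proof. by apply: integral_ge0 => x _; rewrite lee_fin gamma_weight_ge0. Qed.

Let gamma_sigma_additive p : semi_sigma_additive (gamma_weight_measure p).
Proof.
move=> F mF tF mUF; rewrite /gamma_weight_measure ge0_integral_bigcup//=.
- apply: is_cvg_ereal_nneg_natsum_cond => n _ _.
  by apply: integral_ge0 => x _; rewrite lee_fin gamma_weight_ge0.
- apply/measurable_funTS/measurableT_comp => //.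
  exact: measurable_gamma_weight.
- by move=> x _; rewrite lee_fin gamma_weight_ge0.
Qed.

HB.instance Definition _ p := isMeasure.Build _ _ _ (gamma_weight_measure p)
  (gamma0 p) (@gamma_ge0 p) (@gamma_sigma_additive p).

(* Gamma(p, 1) for p > 0, with the usual convention Gamma(0, 1) = delta_0.
   The total mass of [gamma_weight_measure p] is Euler's Gamma function at p,
   which is positive and finite for p > 0, so that the second argument of
   [mnormalize] plays no role. *)
Definition gamma_prob (p : R) : probability R R :=
  let delta0 : probability R R := \d_(0 : R) in
  let gam : probability R R := mnormalize (gamma_weight_measure p) delta0 in
  if p == 0 then delta0 else gam.

Definition normalize_tuple n (y : n.-tuple R) : n.-tuple R :=
  [tuple tnth y i / \sum_(l < n) tnth y l | i < n].

(* Law of (Y_i / (Y_1 + ... + Y_n))_i for independent Y_i ~ Gamma(p_i, 1), so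
   that the parameters p_i may vanish as long as one of them is positive. *)
Definition dirichlet n (p : 'I_n -> R) : set (n.-tuple R) -> \bar R :=
  pushforward (prod_prob (gamma_prob \o p)) (@normalize_tuple n).

End dirichlet.

Section random_measures.
Context {dO dA} {Omega : measurableType dO} {A : measurableType dA} {R : realType}.
Variables (P : probability Omega R) (alpha : {finite_measure set A -> \bar R}).
(* [X i] is the variable X_(i+1) of the usual numbering from 1. *)
Variables (X : nat -> {mfun Omega >-> A}) (D : Omega -> probability A R).

Definition random_probability : Prop :=
  forall C, measurable C -> measurable_fun [set: Omega] (fun w => D w C).

Definition dirichlet_ferguson : Prop :=
  random_probability /\
  forall n (C : 'I_n -> set A),
    (forall i, measurable (C i)) -> trivIset [set: 'I_n] C ->
    \bigcup_i C i = [set: A] ->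
    forall B : set (n.-tuple R), measurable B ->
      P [set w | B [tuple fine (D w (C i)) | i < n]] =
      dirichlet (fun i => fine (alpha (C i))) B.

Definition polya_predictive (past : seq A) (B : set A) : \bar R :=
  ((alpha B + \sum_(a <- past) \d_a B) *
   ((fine (alpha [set: A]) + (size past)%:R)^-1)%:E)%E.

(* The mass given to B_1 x ... x B_k by the iterated kernel
   prod_i (alpha + sum_(l < i) delta_(a_l))(da_i) / (alpha(A) + i - 1). *)
Fixpoint polya_rect (past : seq A) (Bs : seq (set A)) : \bar R :=
  if Bs is B :: Bs' then
    (\int[polya_predictive past]_(a in B) polya_rect (rcons past a) Bs')%E
  else 1%E.

Definition polya_sequence : Prop :=
  forall k (j : k.-tuple nat) (B : k.-tuple (set A)),
    sorted ltn j -> (forall i, measurable (tnth B i)) ->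
    P [set w | forall i : 'I_k, tnth B i (X (tnth j i) w)] = polya_rect [::] B.

Definition empirical_limit : Prop :=
  forall C, measurable C ->
    {ae P, forall w,
      (n%:R^-1 * \sum_(i < n) \1_C (X i w) : R) @[n --> \oo]
        --> fine (D w C)}.

Definition sigma_D : set (set Omega) :=
  <<s \bigcup_(C in measurable)
        preimage_set_system [set: Omega] (fun w => D w C) measurable >>.

Definition L2D (F : Omega -> R) : Prop :=
  (F \in Lfun P 2%:E) /\
  (forall B, measurable B -> sigma_D (F @^-1` B)).

Definition Xvec (n : nat) (w : Omega) : n.-tuple A := [tuple X i w | i < n].

Lemma measurable_Xvec n : measurable_fun [set: Omega] (Xvec n).
Proof.
apply/measurable_fun_tnthP => i.
have -> : (fun t => tnth t i) \o Xvec n = X i; last exact: measurable_funPT.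
by apply/funext => w /=; rewrite tnth_mktuple.
Qed.

HB.instance Definition _ n :=
  isMeasurableFun.Build _ _ _ _ (Xvec n) (@measurable_Xvec n).

(* [g] is a version of z |-> E(Y | Z = z), i.e. E(Y | Z) = g(Z) a.s. *)
Definition cond_exp_version {dZ} {TZ : measurableType dZ}
    (Y : Omega -> R) (Z : Omega -> TZ) (g : TZ -> R) : Prop :=
  [/\ measurable_fun [set: TZ] g,
      P.-integrable [set: Omega] (EFin \o (g \o Z))
    & forall B, measurable B ->
        (\int[P]_(w in Z @^-1` B) (g (Z w))%:E =
         \int[P]_(w in Z @^-1` B) (Y w)%:E)%E].

(* For n = 1 the conditioning variable [Xvec 0] is constant and the last clause
   says E(h(X_1)) = 0. *)
Definition Xi (n : nat) (h : n.-tuple A -> R) : Prop :=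
  [/\ forall (s : {perm 'I_n}) (a : n.-tuple A),
        h [tuple tnth a (s i) | i < n] = h a,
      measurable_fun [set: n.-tuple A] h,
      ('E_P[(fun w => h (Xvec n w) ^+ 2)%R] < +oo)%E
    & cond_exp_version (fun w => h (Xvec n w)) (Xvec n.-1) (fun=> 0)].

Definition hoeffding_decomposition (F : Omega -> R)
    (h : forall n, n.-tuple A -> R) : Prop :=
  ('N[P]_(2%:E)[EFin \o (fun w => F w - (fine 'E_P[F] +
      \sum_(1 <= n < N.+1) \int[power_prob (D w) n]_a h n a))%R])%E
    @[N --> \oo] --> 0%E.

End random_measures.

Section coefficients.
Context {R : realType}.
(* [c] stands for alpha(A). *)
Variable c : R.

Definition fact_ratio (a b : nat) : R := a`!%:R / b`!%:R.

Definition Phi (n m r p : nat) : R :=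
  fact_ratio (m - r) (m - r - p) *
  (\prod_(1 <= s < (m - (r + p)).+1) (c + r%:R + p%:R + s%:R - 1)) /
  (\prod_(1 <= s < (m - r).+1) (c + n%:R + s%:R - 1)).

Definition Psi (N q n m : nat) : R :=
  \sum_(0 <= r < q.+1)
     'C(q, r)%:R * 'C(N - n, m - r)%:R * Phi n m r (q - r).

Definition theta_equations (N : nat) (t : nat -> nat -> R) : Prop :=
  [/\ forall k, (1 <= k < N)%N -> t k k = (Psi N k k k)^-1,
      forall k q, (1 <= k < N)%N -> (1 <= q < k)%N ->
        \sum_(q <= i < k.+1) \sum_(q <= j < i.+1) t i j * Psi N q k j = 0,
      forall a, (1 <= a < N)%N -> t N a = - \sum_(a <= s < N) t s a
    & t N N = 1].

(* The values outside 1 <= a <= k <= N are irrelevant; see [thetaNP] for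
   existence. *)
Definition thetaN (N : nat) : nat -> nat -> R :=
  xget (fun _ _ => 0) (theta_equations N).

Lemma Psi_gt0 (N q k : nat) : 0 < c -> (q <= k)%N -> 0 < Psi N q k q.
Proof.
move=> c0 qk; rewrite /Psi big_nat_recr//= ltr_wpDl//.
  rewrite big_nat; apply: sumr_ge0 => r /andP[_ rq].
  rewrite !mulr_ge0 ?ler0n ?invr_ge0//.
    rewrite big_nat; apply: prodr_ge0 => s /andP[s1 _].
    by rewrite -addrA addr_ge0 ?subr_ge0 ?ler1n// !addr_ge0// ltW.
  rewrite big_nat; apply: prodr_ge0 => s /andP[s1 _].
  by rewrite -addrA addr_ge0 ?subr_ge0 ?ler1n// !addr_ge0// ltW.
by rewrite /Phi /fact_ratio !subnn !bin0 binn addn0 subnn ?big_geq//.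
Qed.

Let back_substitution (k : nat) (v : R) (S P : nat -> R) (Q : nat -> nat -> R) :
  (forall q, (q < k)%N -> P q != 0) ->
  exists u : nat -> R, u k = v /\ forall q, (q < k)%N ->
    S q + (u q * P q + \sum_(q.+1 <= j < k.+1) u j * Q q j) = 0.
Proof.
move=> P0.
suff: forall m, exists u : nat -> R, u k = v /\
    forall q, (q < k)%N -> (k - m <= q)%N ->
    S q + (u q * P q + \sum_(q.+1 <= j < k.+1) u j * Q q j) = 0.
  move=> /(_ k)[u [uk uq]]; exists u; split=> // q qk.
  by apply: uq => //; rewrite subnn.
elim=> [|m [u [uk uq]]].
  exists (fun=> v); split=> // q; rewrite subn0 => qk kq.
  by move: (leq_trans qk kq); rewrite ltnn.
have [km|mk] := leqP k m.
  exists u; split=> // q qk _; apply: uq => //.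
  by move: km; rewrite -subn_eq0 => /eqP ->.
pose q0 := (k - m.+1)%N.
have q0k : (q0 < k)%N by rewrite /q0 ltn_subrL/= (leq_ltn_trans _ mk).
have kmq0 : (k - m = q0.+1)%N by rewrite /q0 subnSK.
pose r0 := - (S q0 + \sum_(q0.+1 <= j < k.+1) u j * Q q0 j) / P q0.
exists (fun j => if j == q0 then r0 else u j).
split; first by rewrite gtn_eqF.
move=> q qk q0q.
under eq_big_nat => j /andP[qj _].
  rewrite gtn_eqF; last exact: leq_ltn_trans q0q qj.
  over.
move: q0q; rewrite -/q0 leq_eqVlt => /orP[/eqP <-|q0q].
  by rewrite eqxx divfK ?P0// opprD -addrA addNr addr0 subrr.
by rewrite gtn_eqF//; apply: uq => //; rewrite kmq0.
Qed.

Lemma thetaNP (N : nat) : 0 < c -> theta_equations N (thetaN N).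
Proof.
move=> c0; apply: xgetPex.
have [t Ht] : exists t : nat -> nat -> R, forall k, (1 <= k < N)%N ->
    t k k = (Psi N k k k)^-1 /\ forall q, (q < k)%N ->
      \sum_(q <= i < k.+1) \sum_(q <= j < i.+1) t i j * Psi N q k j = 0.
  suff: forall K, exists t : nat -> nat -> R, forall k, (1 <= k <= K)%N ->
    t k k = (Psi N k k k)^-1 /\ forall q, (q < k)%N ->
      \sum_(q <= i < k.+1) \sum_(q <= j < i.+1) t i j * Psi N q k j = 0.
    move=> /(_ N)[t tP]; exists t => k /andP[k1 kN].
    by apply: tP; rewrite k1 ltnW.
  elim=> [|K [t tP]].
    by exists (fun _ _ => 0) => k /andP[]; case: k.
  have P0 q : (q < K.+1)%N -> Psi N q K.+1 q != 0.
    by move=> qK; rewrite gt_eqF// Psi_gt0// ltnW.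
  have [u [uK uq]] := @back_substitution K.+1 (Psi N K.+1 K.+1 K.+1)^-1
    (fun q => \sum_(q <= i < K.+1) \sum_(q <= j < i.+1) t i j * Psi N q K.+1 j)
    (fun q => Psi N q K.+1 q) (fun q j => Psi N q K.+1 j) P0.
  exists (fun i j => if i == K.+1 then u j else t i j) => k /andP[k1].
  rewrite leq_eqVlt => /orP[/eqP ->|kK].
    rewrite eqxx; split => // q qK.
    rewrite big_nat_recr/=; last exact: ltnW.
    rewrite eqxx -[RHS](uq q qK); congr (_ + _).
      by apply: eq_big_nat => i /andP[_ iK]; rewrite ltn_eqF.
    by rewrite big_ltn// ltnW.
  have kK' : (1 <= k <= K)%N by rewrite k1.
  have [tk tq] := tP k kK'.
  rewrite ltn_eqF//; split => // q qk.
  rewrite -[RHS](tq q qk); apply: eq_big_nat => i /andP[_ ik].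
  by rewrite ltn_eqF// (leq_ltn_trans _ kK).
exists (fun k a => if k == N then
  (if a == N then 1 else - \sum_(a <= s < N) t s a) else t k a); split.
- by move=> k /[dup] /andP[_ kN] /Ht[tk _]; rewrite ltn_eqF.
- move=> k q /[dup] /andP[_ kN] /Ht[_ tk] /andP[_ qk].
  rewrite -[RHS](tk q qk); apply: eq_big_nat => i /andP[_ ik].
  by rewrite ltn_eqF// (leq_ltn_trans _ kN).
- move=> a /andP[_ aN]; rewrite eqxx ltn_eqF//; congr (- _).
  by apply: eq_big_nat => s /andP[_ sN]; rewrite ltn_eqF.
- by rewrite !eqxx.
Qed.

Definition theta (k a : nat) : R :=
  limn (fun N => 'C(N, k)%:R * (thetaN N k a / 'C(N - a, k - a)%:R)).

End coefficients.

(* Main.v *)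
(* Write c = alpha(A) and (x)_n for the rising factorial. Given D the X_i are
   i.i.d. with law D, so the conditional expectation of the integral of h_n against
   D^n given X_1, ..., X_k is that of h_n(X_(k+1), ..., X_(k+n)). By Polya's
   predictive rule the degeneracy of h_n says that integrating one variable against
   alpha amounts to minus the sum over the other variables; moving the future
   observations to the past one by one with this identity gives
     E(int h_n dD^n | X_1, ..., X_k) = n! / (c + k)_n * sum of h_n over n-subsets,
   which vanishes for n > k. Hence E(F - E(F) | X_1, ..., X_k) is a triangular
   combination of h_1, ..., h_k. The equations defining theta_N, rescaled by
   binomial coefficients, converge to a triangular system too; its solution, and the
   fact that the resulting theta inverts the first system, both reduce to the
   vanishing of the d-th finite difference of a polynomial of degree < d. *)

Require Import Defs.
From HB Require Import structures.
From mathcomp Require Import all_boot all_order all_algebra perm.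
From mathcomp Require Import all_classical all_reals all_analysis measurable_realfun giry.
From mathcomp Require Import ring lra zify.

Set Implicit Arguments.
Unset Strict Implicit.
Unset Printing Implicit Defensive.

Import Order.TTheory GRing.Theory Num.Theory.
Import numFieldNormedType.Exports.

Local Open Scope classical_set_scope.
Local Open Scope ring_scope.

(** * Coefficients *)

(** Conditional expectations are never formed: with X^k = (X_1, ..., X_k), each identity between
    them is tested on the events {X^k in B} and becomes an identity of integrals. There only the
    terms n <= k of the decomposition of F survive, so L^2 convergence enters through one norm bound
    on the remainder. Degeneracy of h_n holds only almost surely under the law of X^(n-1) and must
    be carried to other index sets. Vectors of X at increasing indices have the same law and h_n is
    symmetric; together this replaces exchangeability. The i.i.d. property given D is used in one
    form: X^k and a sample of size n from D have jointly the law of X^(k+n). It comes from the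
    empirical limit by bounded convergence. As to the coefficients, the equations of level k contain
    theta_N^(i,j) only through its sum over j <= i <= k. These sums, times 'C(N, j), have a limit,
    and the difference of the limits at levels n and n - 1 yields theta^(n,k) = (-1)^(n-k) (c + 2n -
    1) (c + k)_(n-1) / n!. *)

Section rising_factorial.
Context {R : realType}.
Implicit Types x c : R.

Definition rising x n : R := \prod_(0 <= i < n) (x + i%:R).

Lemma rising0 x : rising x 0 = 1.
Proof. by rewrite /rising big_geq. Qed.

Lemma risingS x n : rising x n.+1 = x * rising (x + 1) n.
Proof.
rewrite /rising big_nat_recl//= addr0; congr (_ * _).
by apply: eq_bigr => i _; rewrite -natr1 -addrA [1 + _]addrC.
Qed.

Lemma risingD x m n : rising x (m + n) = rising x m * rising (x + m%:R) n.
Proof.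
elim: m x => [|m IH] x; first by rewrite rising0 mul1r addr0.
by rewrite addSn !risingS IH mulrA -addrA [1 + _]addrC natr1.
Qed.

Lemma risingSr x n : rising x n.+1 = rising x n * (x + n%:R).
Proof. by rewrite -addn1 risingD /rising big_nat1 addr0. Qed.

Lemma rising_gt0 x n : 0 < x -> 0 < rising x n.
Proof.
by move=> x0; rewrite /rising; apply: prodr_gt0 => i _; rewrite ltr_wpDr ?ler0n.
Qed.

Lemma rising_diff x n : rising (x + 1) n.+1 - rising x n.+1 = n.+1%:R * rising (x + 1) n.
Proof. by rewrite risingSr risingS -addrA [1 + n%:R]addrC natr1; ring. Qed.

(** Pascal's rule turns a difference of order d + 1 into one of order d of a first difference. The
    first difference of a rising factorial is again one, of degree one less and based at x + 1, so
    the degree runs out before the order. *)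
Lemma alternating_bin_sum_rising d e x : (e < d)%N ->
  \sum_(0 <= i < d.+1) (-1) ^+ i * 'C(d, i)%:R * rising (x + i%:R) e = 0.
Proof.
elim: d e x => // d IH e x ed.
have -> : \sum_(0 <= i < d.+2) (-1) ^+ i * 'C(d.+1, i)%:R * rising (x + i%:R) e =
  \sum_(0 <= i < d.+1) (-1) ^+ i * 'C(d, i)%:R *
    (rising (x + i%:R) e - rising (x + i%:R + 1) e).
  rewrite big_nat_recl// bin0 expr0 !mul1r addr0.
  under eq_bigr => i _ do rewrite binS natrD mulrDr mulrDl.
  rewrite big_split/= addrA [X in X + _ + _ = _](_ : _ = rising (x + 0%:R) e);
    last by rewrite addr0.
  under [RHS]eq_bigr => i _ do rewrite mulrBr.
  rewrite sumrB; congr (_ + _).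
    rewrite [RHS]big_nat_recl// bin0 expr0 !mul1r; congr (_ + _).
    by rewrite big_nat_recr//= bin_small// mulr0 mul0r addr0.
  rewrite -sumrN; apply: eq_bigr => i _.
  by rewrite exprS !mulN1r !mulNr -[x + i%:R + 1]addrA natr1.
case: e ed => [|e] ed.
  by rewrite big1// => i _; rewrite !rising0 subrr mulr0.
under eq_bigr => i _.
  rewrite -opprB rising_diff -[x + i%:R + 1]addrA [i%:R + 1]addrC addrA mulrN.
  rewrite mulrCA -mulNr.
  over.
by rewrite /= -mulr_sumr IH// mulr0.
Qed.

End rising_factorial.

Lemma cvg_sum_seq (R : realType) (I : eqType) (s : seq I) (u : I -> nat -> R) (l : I -> R) :
  (forall i, i \in s -> u i N @[N --> \oo] --> l i) ->
  (\sum_(i <- s) u i N) @[N --> \oo] --> \sum_(i <- s) l i.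
Proof.
elim: s => [|x s IH] H.
  by rewrite big_nil; under eq_fun do rewrite big_nil; exact: cvg_cst.
rewrite big_cons; under eq_fun do rewrite big_cons.
by apply: cvgD; [apply: H; rewrite mem_head|apply: IH => i si; apply: H; rewrite in_cons si orbT].
Qed.

(* Back substitution is continuous: the solutions of an upper triangular
   system converge when its coefficients do. *)
Lemma triangular_cvg (R : realType) (k : nat) (M : nat -> nat -> nat -> R)
    (m : nat -> nat -> R) (u : nat -> nat -> R) (v b : nat -> R) :
  (forall q j, (0 < q <= j)%N -> (j <= k)%N -> M q j N @[N --> \oo] --> m q j) ->
  (forall q, (0 < q <= k)%N -> m q q != 0) ->
  (forall q, (0 < q <= k)%N ->
     \forall N \near \oo, \sum_(q <= j < k.+1) u j N * M q j N = b q) ->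
  (forall q, (0 < q <= k)%N -> \sum_(q <= j < k.+1) v j * m q j = b q) ->
  forall q, (0 < q <= k)%N -> u q N @[N --> \oo] --> v q.
Proof.
move=> Mm m0 ub vb.
suff: forall e q, (0 < q <= k)%N -> (k - q < e)%N -> u q N @[N --> \oo] --> v q.
  by move=> + q qk => /(_ (k - q).+1 q qk); apply.
elim=> // e IH q /[dup] qk /andP[q0 qk'] kqe.
have -> : v q = (b q - \sum_(q.+1 <= j < k.+1) v j * m q j) * (m q q)^-1.
  by rewrite -vb// big_ltn// addrK mulfK ?m0.
have Mqq : M q q N @[N --> \oo] --> m q q by apply: Mm => //; rewrite q0 leqnn.
have H : (b q - \sum_(q.+1 <= j < k.+1) u j N * M q j N) * (M q q N)^-1 @[N --> \oo]
    --> (b q - \sum_(q.+1 <= j < k.+1) v j * m q j) * (m q q)^-1.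
  apply: cvgM; last by apply: cvgV => //; exact: m0.
  apply: cvgB; first exact: cvg_cst.
  apply: cvg_sum_seq => j; rewrite mem_index_iota ltnS => /andP[qj jk].
  by apply: cvgM; [apply: IH|apply: Mm] => //; lia.
move: H; apply: cvg_trans; apply: near_eq_cvg; near=> N.
have <- : \sum_(q <= j < k.+1) u j N * M q j N = b q by near: N; exact: ub.
rewrite big_ltn// addrK mulfK//.
near: N; move/cvgrPdist_lt : Mqq => /(_ _ (_ : 0 < `|m q q|)).
rewrite normr_gt0 m0// => /(_ isT); apply: filterS => N.
by apply: contraTneq => ->; rewrite subr0 ltxx.
Unshelve. all: by end_near.
Qed.

(** * Limit of the equations for theta_N and closed form of theta *)

Section coefficient_limit.
Context {R : realType}.
Variable c : R.
Hypothesis c0 : 0 < c.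

(** The recurrence (i + 1) 'C(M, i + 1) = (M - i) 'C(M, i) with M = N - k shows that passing from i
    to i + 1 multiplies the ratio by (1 - (k + i) / N) / (i + 1). *)
Lemma bin_cvg (k i : nat) :
  ('C(N - k, i)%:R / N%:R ^+ i : R) @[N --> \oo] --> (i`!%:R^-1 : R).
Proof.
elim: i => [|i IH].
  rewrite (_ : (fun N => _) = (fun=> 0`!%:R^-1 : R)); last first.
    by apply/funext => N; rewrite bin0 expr0 fact0 divr1 invr1.
  exact: cvg_cst.
have H1 : ((N%:R : R)^-1) @[N --> \oo] --> (0 : R).
  have := @cvg_harmonic R.
  rewrite -(cvg_shiftS (fun N => (N%:R : R)^-1)).
  by apply.
have H2 : ((1 - (k + i)%:R * N%:R^-1) * i.+1%:R^-1 : R) @[N --> \oo] --> (i.+1%:R^-1 : R).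
  rewrite [X in _ --> X](_ : _ = (1 - (k + i)%:R * 0) * i.+1%:R^-1 :> R); last first.
    by rewrite mulr0 subr0 mul1r.
  by apply: cvgMl; apply: cvgB; [exact: cvg_cst|exact: cvgMr].
have H3 : ('C(N - k, i)%:R / N%:R ^+ i * ((1 - (k + i)%:R * N%:R^-1) * i.+1%:R^-1) : R)
    @[N --> \oo] --> (i`!%:R^-1 * i.+1%:R^-1 : R) by exact: cvgM.
move: H3; rewrite -invfM -natrM mulnC -factS; apply: cvg_trans.
apply: near_eq_cvg; near=> N.
have NK : (k + i < N)%N by near: N; exact: nbhs_infty_gt.
have N0 : (N%:R : R) != 0 by rewrite pnatr_eq0; lia.
have : (i.+1 * 'C(N - k, i.+1) = (N - k - i) * 'C(N - k, i))%N by exact: mul_bin_left.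
move=> /(congr1 (fun x => x%:R : R)); rewrite !natrM.
have -> : ((N - k - i)%N%:R : R) = N%:R - (k + i)%:R by rewrite -subnDA natrB// ltnW.
move=> E.
have -> : ('C(N - k, i.+1)%:R : R) = (N%:R - (k + i)%:R) * 'C(N - k, i)%:R / i.+1%:R.
  by rewrite -E mulrC mulrA mulVf ?pnatr_eq0// mul1r.
rewrite exprSr /=; field.
by rewrite N0 expf_neq0//= pnatr_eq0.
Unshelve. all: by end_near.
Qed.

(** Each of the r missing elements costs a factor of order 1 / N. *)
Lemma bin_ratio_cvg (k j r : nat) : (r <= j)%N ->
  ('C(N - k, j - r)%:R / 'C(N, j)%:R : R) @[N --> \oo] --> ((r == 0)%N%:R : R).
Proof.
move=> rj.
have H0 : (((N%:R : R)^-1) ^+ r) @[N --> \oo] --> ((r == 0)%N%:R : R).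
  rewrite -expr0n; apply: (@cvg_comp _ _ _ (fun N => (N%:R : R)^-1) (fun x => x ^+ r));
    last exact: exprn_continuous.
  have := @cvg_harmonic R.
  rewrite -(cvg_shiftS (fun N => (N%:R : R)^-1)).
  by apply.
have H1 := @bin_cvg k (j - r).
have H2 := @bin_cvg 0 j.
have fj : (j`!%:R^-1 : R) != 0 by rewrite invr_neq0// pnatr_eq0 -lt0n fact_gt0.
have H3 : ('C(N - k, j - r)%:R / N%:R ^+ (j - r) * ('C(N - 0, j)%:R / N%:R ^+ j)^-1 *
    (N%:R^-1) ^+ r : R) @[N --> \oo] --> ((j - r)`!%:R^-1 * (j`!%:R^-1)^-1 * (r == 0)%N%:R : R).
  by apply: cvgM => //; apply: cvgM => //; exact: cvgV.
move: H3.
have -> : (j - r)`!%:R^-1 * (j`!%:R^-1)^-1 * (r == 0)%N%:R = (r == 0)%N%:R :> R.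
  case: eqP => [->|_]; last by rewrite mulr0.
  by rewrite subn0 mulr1 mulfV.
apply: cvg_trans.
apply: near_eq_cvg; near=> N.
have N0 : (N%:R : R) != 0 by rewrite pnatr_eq0 -lt0n; near: N; exact: nbhs_infty_gt.
have Nj : ('C(N, j)%:R : R) != 0 by rewrite pnatr_eq0 -lt0n bin_gt0; near: N; exact: nbhs_infty_ge.
rewrite /= subn0.
have -> : (N%:R : R) ^+ j = N%:R ^+ (j - r) * N%:R ^+ r by rewrite -exprD subnK.
rewrite exprVn; field.
by rewrite Nj !expf_neq0.
Unshelve. all: by end_near.
Qed.

Lemma Phi_rising (n m r p : nat) : (r + p <= m)%N ->
  Phi c n m r p = (m - r)`!%:R / (m - r - p)`!%:R *
    rising (c + (r + p)%:R) (m - (r + p)) / rising (c + n%:R) (m - r).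
Proof.
move=> rpm; rewrite /Phi /fact_ratio /rising; congr (_ * _ / _).
  rewrite big_add1; apply: eq_bigr => i _.
  by rewrite natrD -natr1; ring.
rewrite big_add1; apply: eq_bigr => i _.
by rewrite -natr1; ring.
Qed.

(** Only the term r = 0 of [Psi] is of the order of 'C(N, j). *)
Lemma Psi_cvg (q k j : nat) : (q <= j)%N ->
  (Psi c N q k j / 'C(N, j)%:R) @[N --> \oo] -->
  (j`!%:R / (j - q)`!%:R * rising (c + q%:R) (j - q) / rising (c + k%:R) j : R).
Proof.
move=> qj.
pose u r N : R := 'C(q, r)%:R * ('C(N - k, j - r)%:R / 'C(N, j)%:R) * Phi c k j r (q - r).
pose l r : R := 'C(q, r)%:R * (r == 0)%N%:R * Phi c k j r (q - r).
rewrite (_ : (fun N => _) = (fun N => \sum_(0 <= r < q.+1) u r N)); last first.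
  apply/funext => N; rewrite /Psi mulr_suml; apply: eq_bigr => r _.
  by rewrite /u; ring.
have -> : j`!%:R / (j - q)`!%:R * rising (c + q%:R) (j - q) / rising (c + k%:R) j =
  \sum_(0 <= r < q.+1) l r.
  rewrite big_nat_recl//= big1 ?addr0; last by move=> i _; rewrite /l mulr0 mul0r.
  by rewrite /l bin0 eqxx !mul1r Phi_rising ?add0n ?subn0.
apply: cvg_sum_seq => i; rewrite mem_index_iota ltnS => /= iq.
by apply: cvgMl; apply: cvgMr; apply: bin_ratio_cvg; exact: leq_trans iq qj.
Qed.

(* The limit of ['C(N, j)] times the sum of [thetaN N i j] over [j <= i <= k]. *)
Definition theta_sum_lim (k j : nat) : R :=
  if (j <= k)%N then (-1) ^+ (k - j) * rising (c + j%:R) k / (j`!%:R * (k - j)`!%:R) else 0.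

(** With j = i + q, the rising factorials combine into a factor free of i. What remains is the
    alternating sum of the binomials 'C(k - q, i), which is zero unless q = k. *)
Lemma theta_sum_limP (k q : nat) : (0 < q <= k)%N ->
  \sum_(q <= j < k.+1) theta_sum_lim k j *
    (j`!%:R / (j - q)`!%:R * rising (c + q%:R) (j - q) / rising (c + k%:R) j) =
  (q == k)%:R.
Proof.
move=> /andP[q0 qk].
have f0 n : (n`!%:R : R) != 0 by rewrite pnatr_eq0 -lt0n fact_gt0.
have r0 x n : (rising (c + x%:R) n : R) != 0 by rewrite gt_eqF// rising_gt0// ltr_wpDr.
pose K : R := rising (c + q%:R) (k - q) / (k - q)`!%:R.
transitivity (K * \sum_(0 <= i < (k - q).+1) (-1) ^+ (k - q) * ((-1) ^+ i * 'C(k - q, i)%:R *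
  rising (0 + i%:R) 0)).
  rewrite -{1}(addn0 q) addnC big_addn subSn// mulr_sumr.
  apply: eq_big_nat => i /andP[_]; rewrite ltnS => ikq.
  have ik : (i + q <= k)%N by lia.
  rewrite /theta_sum_lim ik rising0 addnK mulr1.
  have -> : (-1) ^+ (k - (i + q)) = (-1) ^+ (k - q) * (-1) ^+ i :> R.
    by rewrite -exprD (_ : (k - q + i = k - (i + q) +
      i * 2)%N) ?exprD ?exprM ?sqrr_sign ?mulr1//; lia.
  have -> : ('C(k - q, i)%:R : R) = (k - q)`!%:R / (i`!%:R * (k - (i + q))`!%:R).
    rewrite -(bin_fact ikq) natrM natrM (_ : (k - q - i = k - (i + q))%N); last lia.
    by rewrite mulfK// mulf_neq0.
  (* Both sides are the rising factorial of c + q of length k + i, cut after i factors on the left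
     and after k - q factors on the right. *)
  have E : rising (c + (i + q)%:R) k * rising (c + q%:R) i =
    rising (c + q%:R) (k - q) * rising (c + k%:R) (i + q).
    rewrite mulrC (_ : c + (i + q)%:R = c + q%:R + i%:R); last by rewrite natrD; ring.
    rewrite -risingD (_ : c + k%:R = c + q%:R + (k - q)%:R); last first.
      by rewrite -addrA -natrD subnKC.
    by rewrite -risingD; congr rising; lia.
  rewrite /K; transitivity ((-1) ^+ (k - q) * (-1) ^+ i * (rising (c + (i +
    q)%:R) k * rising (c + q%:R) i) / (rising (c + k%:R) (i + q) * i`!%:R * (k - (i + q))`!%:R)).
    by field; rewrite !f0 !r0.
  by rewrite E; field; rewrite !f0 !r0.
have [qE|qk'] := eqVneq q k.
  by rewrite /K qE !subnn big_nat1 !rising0 bin0 !expr0 fact0 !mul1r invr1 /= mulr1.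
by rewrite -mulr_sumr alternating_bin_sum_rising ?mulr0// lt0n subn_eq0 -ltnNge ltn_neqAle qk'.
Qed.

(** In the equations of level k, exchanging the two sums isolates the sum of [thetaN c N i j] over j
    <= i <= k. Taking these sums as unknowns makes the system triangular, and the weight 'C(N, j) is
    the one for which its matrix converges. The equations hold for k < N, hence only for large N. *)
Lemma thetaN_sum_cvg (k j : nat) : (0 < j <= k)%N ->
  ('C(N, j)%:R * \sum_(j <= i < k.+1) thetaN c N i j) @[N --> \oo] --> theta_sum_lim k j.
Proof.
move: j; apply: (@triangular_cvg _ k (fun q j N => Psi c N q k j / 'C(N, j)%:R) _
   _ _ (fun q => (q == k)%:R)).
- by move=> q j /andP[_ qj] _; exact: Psi_cvg.
- move=> q qk; apply: lt0r_neq0; rewrite !divr_gt0 ?mulr_gt0 ?divr_gt0 ?rising_gt0 ?ltr0n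
  ?fact_gt0// ltr_wpDr//.
- move=> q /andP[q0 qk]; near=> N.
  have kN : (k < N)%N by near: N; exact: nbhs_infty_gt.
  have [H1 H2 _ _] := thetaNP N c0.
  have -> : \sum_(q <= j < k.+1) 'C(N, j)%:R * (\sum_(j <= i < k.+1) thetaN c N i j) *
    (Psi c N q k j / 'C(N, j)%:R)
    = \sum_(q <= j < k.+1) \sum_(j <= i < k.+1) thetaN c N i j * Psi c N q k j.
    apply: eq_big_nat => j /andP[_ jk].
    have : ('C(N, j)%:R : R) != 0 by rewrite pnatr_eq0 -lt0n bin_gt0; lia.
    by rewrite -mulr_suml => ?; field.
  (* The last row is the normalisation of the diagonal coefficient by the inverse of [Psi], with
     right side 1; the other rows are homogeneous. *)
  have [->|qk'] := eqVneq q k.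
    rewrite !big_nat1 H1 ?mulVf//; last by rewrite kN (leq_trans q0).
    by rewrite gt_eqF// Psi_gt0.
  rewrite -[RHS](H2 k q); last 2 first.
  - by rewrite kN (leq_trans q0).
  - by rewrite q0 ltn_neqAle qk'.
  rewrite (eq_big_nat _ _ (F2 := fun j => \sum_(q <= i < k.+1 | (j <= i)%N) thetaN c N i j *
    Psi c N q k j)); last first.
    by move=> j /andP[qj jk]; rewrite (big_nat_widenl _ q).
  rewrite (exchange_big_dep_nat xpredT)//=; apply: eq_big_nat => i /andP[qi ik].
  by rewrite [RHS](big_nat_widen _ _ k.+1).
- exact: theta_sum_limP.
Unshelve. all: by end_near.
Qed.

(** The closed form of theta^(n,k): the difference of [theta_sum_lim] at levels n and n - 1, divided
    by 'C(n, k). The factor c + 2n - 1 arises as (c + k + n - 1) + (n - k) when the two levels are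
    added up. *)
Definition theta_limit (n k : nat) : R :=
  (-1) ^+ (n - k) * (c + n.*2%:R - 1) / n`!%:R * rising (c + k%:R) n.-1.

(** A single coefficient is the difference of two consecutive partial sums, and 'C(N, n) 'C(n, k) =
    'C(N, k) 'C(N - k, n - k) trades the normalisation in [theta] for 'C(N, k) / 'C(n, k), the one
    of [thetaN_sum_cvg]. *)
Lemma theta_limitE (n k : nat) : (0 < k <= n)%N -> theta c n k = theta_limit n k.
Proof.
move=> /andP[k0 kn]; apply/cvg_lim => //.
have f0 i : (i`!%:R : R) != 0 by rewrite pnatr_eq0 -lt0n fact_gt0.
have Cnk : ('C(n, k)%:R : R) != 0 by rewrite pnatr_eq0 -lt0n bin_gt0.
have -> : theta_limit n k = (theta_sum_lim n k - theta_sum_lim n.-1 k) / 'C(n, k)%:R.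
  case: n kn Cnk => [|n] kn Cnk; first by move: k0; rewrite ltnNge kn.
  have Cf : ('C(n.+1, k)%:R : R) = n.+1`!%:R / (k`!%:R * (n.+1 - k)`!%:R).
    by rewrite -(bin_fact kn) natrM natrM mulfK// mulf_neq0.
  rewrite /theta_limit /theta_sum_lim kn Cf /=.
  have [kn'|] := leqP k n.
    rewrite -(subnKC kn'); move: (n - k)%N => d.
    rewrite addKn (_ : ((k + d).+1 - k)%N = d.+1); last by lia.
    have d0 : (d%:R + 1 : R) != 0 by rewrite natr1 pnatr_eq0.
    have kd0 : (k%:R + d%:R + 1 : R) != 0 by rewrite -natrD natr1 pnatr_eq0.
    rewrite exprS risingSr !factS !natrM -mul2n natrM -!natr1 natrD.
    by field; rewrite !f0 d0 kd0.
  move=> nk; have -> : k = n.+1 by lia.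
  rewrite subnn risingSr -mul2n natrM -!natr1; field.
  by rewrite !f0.
have H1 : ('C(N, k)%:R * \sum_(k <= i < n.+1) thetaN c N i k) @[N --> \oo] --> theta_sum_lim n k.
  by apply: thetaN_sum_cvg; rewrite k0.
have H2 : ('C(N, k)%:R * \sum_(k <= i < n.-1.+1) thetaN c N i k) @[N --> \oo] --> theta_sum_lim
  n.-1 k.
  (* For k = n the sum of level n - 1 is empty, in agreement with the value 0 that [theta_sum_lim]
     takes beyond its level. *)
  have [kn1|nk] := leqP k n.-1; first by apply: thetaN_sum_cvg; rewrite k0.
  rewrite /theta_sum_lim leqNgt nk/=; under eq_fun do rewrite big_geq// mulr0.
  exact: cvg_cst.
have H3 : ('C(N, k)%:R * (\sum_(k <= i < n.+1) thetaN c N i k) - 'C(N, k)%:R *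
  (\sum_(k <= i < n.-1.+1) thetaN c N i k))
   / 'C(n, k)%:R @[N --> \oo] --> (theta_sum_lim n k - theta_sum_lim n.-1 k) / 'C(n, k)%:R.
  by apply: cvgMl; exact: cvgB.
move: H3; apply: cvg_trans; apply: near_eq_cvg; near=> N.
have nN : (n <= N)%N by near: N; exact: nbhs_infty_ge.
have CN : ('C(N - k, n - k)%:R : R) != 0 by rewrite pnatr_eq0 -lt0n bin_gt0; lia.
have E : ('C(N, n)%:R * 'C(n, k)%:R : R) = 'C(N, k)%:R * 'C(N - k, n - k)%:R.
  have /(congr1 (fun x => x%:R : R)) := bin_fact nN.
  have NkN : (n - k <= N - k)%N by lia.
  have /(congr1 (fun x => x%:R : R)) := bin_fact NkN.
  have /(congr1 (fun x => x%:R : R)) := bin_fact kn.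
  have kN : (k <= N)%N by lia.
  have /(congr1 (fun x => x%:R : R)) := bin_fact kN.
  rewrite (_ : (N - k - (n - k) = N - n)%N); last lia.
  rewrite !natrM => E1 E2 E3 E4.
  apply: (mulIf (f0 n)); apply: (mulIf (f0 (N - n)%N)).
  transitivity (N`!%:R * 'C(n, k)%:R : R); first by rewrite -E4; ring.
  by rewrite -E1 -E3 -E2; ring.
rewrite prednK; last by lia.
rewrite big_nat_recr//= mulrDr addrC addKr.
apply: (mulIf Cnk); rewrite mulfVK//.
apply: (mulIf CN); rewrite [LHS]mulrAC -E; field.
by rewrite CN.
Unshelve. all: by end_near.
Qed.

(** The quotient of (c + k)_(n-1) by (c + k)_m is (c + k + m)_(n-1-m), a polynomial in k of degree n
    - 1 - m, and the signed binomials form a difference of order n - m. This is the matrix identity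
    by which theta inverts the system expressing the projections of F through the kernels. *)
Lemma theta_limit_inversion (n m : nat) : (0 < m <= n)%N ->
  \sum_(m <= k < n.+1) theta_limit n k * (m`!%:R / rising (c + k%:R) m) * 'C(n - m, k - m)%:R =
    (m == n)%:R.
Proof.
move=> /andP[m0 mn].
have f0 i : (i`!%:R : R) != 0 by rewrite pnatr_eq0 -lt0n fact_gt0.
have r0 x i : (rising (c + x%:R) i : R) != 0 by rewrite gt_eqF// rising_gt0// ltr_wpDr.
have n0 : (0 < n)%N by lia.
(* The diagonal case stands apart: there n - 1 - m would be a truncated subtraction and the degree
   would not be below the order. *)
have [->|mn'] := eqVneq m n.
  rewrite big_nat1 /theta_limit !subnn bin0 expr0.
  case: n n0 {mn} => // n _.
  rewrite risingSr -mul2n natrM -!natr1; field.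
  rewrite !natr1 f0 r0/= andbT -addrA gt_eqF// ltr_wpDr// addr_ge0//.
have mn1 : (m < n)%N by rewrite ltn_neqAle mn'.
transitivity ((c + n.*2%:R - 1) / n`!%:R * m`!%:R * ((-1) ^+ (n - m) *
  \sum_(0 <= i < (n - m).+1) ((-1) ^+ i * 'C(n - m, i)%:R * rising (c + m.*2%:R +
    i%:R) (n.-1 - m)))); last first.
  by rewrite alternating_bin_sum_rising ?mulr0//; lia.
rewrite -{1}(add0n m) big_addn subSn// !mulr_sumr.
apply: eq_big_nat => i /andP[_]; rewrite ltnS => inm.
rewrite /theta_limit addnK.
have -> : (-1) ^+ (n - (i + m)) = (-1) ^+ (n - m) * (-1) ^+ i :> R.
  by rewrite -exprD (_ : (n - m + i = n - (i + m) + i * 2)%N) ?exprD ?exprM ?sqrr_sign ?mulr1//;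
    lia.
have -> : rising (c + (i + m)%:R) n.-1 = rising (c + (i + m)%:R) m * rising (c + m.*2%:R +
  i%:R) (n.-1 - m).
  rewrite -{1}(@subnKC m n.-1); last lia.
  rewrite risingD; congr (_ * rising _ _).
  by rewrite -addnn !natrD; ring.
by field; rewrite !f0 !r0.
Qed.

End coefficient_limit.

(** * Sums over subsequences *)

Section subsequences.
Context {T : Type}.
Implicit Types s : seq T.

(** Choices of k positions rather than of k values: repeated entries count with multiplicity, as
    they do in a sum over j_1 < ... < j_k. *)
Fixpoint subseqs k s : seq (seq T) :=
  match k, s with
  | 0, _ => [:: [::]]
  | k'.+1, [::] => [::]
  | k'.+1, x :: s' => map (cons x) (subseqs k' s') ++ subseqs k s'
  end.

Lemma subseqs0 s : subseqs 0 s = [:: [::]].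
Proof. by case: s. Qed.

Lemma all_size_subseqs k s : all (fun t => size t == k) (subseqs k s).
Proof.
elim: s k => [|x s IH] [|k]//=.
rewrite all_cat IH andbT all_map; apply: sub_all (IH k) => t /eqP <-.
by rewrite /= eqxx.
Qed.

Lemma subseqs_eq0 k s : (size s < k)%N -> subseqs k s = [::].
Proof.
elim: s k => [|x s IH] [|k]//=; rewrite ltnS => sk.
by rewrite !IH// ltnW.
Qed.

Lemma subseqs_full s : subseqs (size s) s = [:: s].
Proof. by elim: s => //= x s ->; rewrite subseqs_eq0. Qed.

Lemma sum_subseqs0 (V : nmodType) (f : seq T -> V) s :
  \sum_(t <- subseqs 0 s) f t = f [::].
Proof. by rewrite subseqs0 big_seq1. Qed.

Lemma sum_subseqsS (V : nmodType) (f : seq T -> V) k x s :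
  \sum_(t <- subseqs k.+1 (x :: s)) f t =
  \sum_(t <- subseqs k s) f (x :: t) + \sum_(t <- subseqs k.+1 s) f t.
Proof. by rewrite /= big_cat big_map. Qed.

Lemma eq_sum_subseqs (V : nmodType) (f g : seq T -> V) k s :
  (forall t, size t = k -> f t = g t) ->
  \sum_(t <- subseqs k s) f t = \sum_(t <- subseqs k s) g t.
Proof.
move=> fg; have := all_size_subseqs k s.
elim: (subseqs k s) => [|t l IH]/=; first by rewrite !big_nil.
by move=> /andP[/eqP tk lk]; rewrite !big_cons fg// IH.
Qed.

(** Double counting: m given positions lie in 'C(size s - m, k - m) sets of k positions. *)
Lemma sum_subseqs_subseqs (R : pzRingType) (f : seq T -> R) m k s : (m <= k)%N ->
  \sum_(t <- subseqs k s) \sum_(r <- subseqs m t) f r =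
  'C(size s - m, k - m)%:R * \sum_(r <- subseqs m s) f r.
Proof.
elim: s m k f => [|x s IH] m [|k] f mk.
- by move: mk; rewrite leqn0 => /eqP ->; rewrite !sum_subseqs0 bin0 mul1r.
- rewrite big_nil; case: m mk => [|m] mk; last by rewrite big_nil mulr0.
  by rewrite bin0n mul0r.
- by move: mk; rewrite leqn0 => /eqP ->; rewrite !sum_subseqs0 bin0 mul1r.
rewrite sum_subseqsS; case: m mk => [|m] mk.
  rewrite (eq_bigr (fun t => \sum_(r <- subseqs 0 t) f r)); last first.
    by move=> t _; rewrite !sum_subseqs0.
  by rewrite !IH// !subn0 -mulrDl -natrD addnC -binS !sum_subseqs0.
rewrite (eq_bigr _ (fun t _ => sum_subseqsS f m x t)) big_split/=.
rewrite (IH m k (fun r => f (x :: r)) mk) -addrA (IH m.+1 k.+1 f mk) !subSS.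
rewrite big_cat big_map/= mulrDr; congr (_ + _).
have [km|mk'] := leqP k m.
  have -> : k = m by apply/eqP; rewrite eqn_leq km.
  rewrite subnn !bin0 (@eq_sum_subseqs _ _ (fun=> 0)) => [|t tm].
    by rewrite big1 ?add0r.
  by rewrite subseqs_eq0 ?big_nil// tm.
rewrite IH//; have [sm|ms] := leqP (size s) m.
  by rewrite (subseqs_eq0 (s := s))// big_nil !mulr0 addr0.
rewrite -mulrDl -natrD; congr (_%:R * _).
rewrite (_ : (size s - m = (size s - m.+1).+1)%N); last by rewrite subnSK.
by rewrite (_ : (k - m = (k - m.+1).+1)%N) ?binS 1?addnC//; rewrite subnSK.
Qed.

End subsequences.

Lemma sum_subseqs_map (T T' : Type) (V : nmodType) (g : T -> T') (f : seq T' -> V) k s :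
  \sum_(t <- subseqs k (map g s)) f t = \sum_(t <- subseqs k s) f (map g t).
Proof.
elim: s k f => [|x s IH] [|k] f; rewrite ?sum_subseqs0//=; first by rewrite !big_nil.
by rewrite !big_cat !big_map/= (IH k.+1) (IH k (fun t => f (g x :: t))).
Qed.

Section subsequences_eqType.
Context {T : eqType}.
Implicit Types s : seq T.

Lemma mem_subseqs k s t : (t \in subseqs k s) = subseq t s && (size t == k).
Proof.
elim: s k t => [|x s IH] [|k] t.
- by rewrite inE; case: t.
- by rewrite in_nil; case: t.
- by rewrite subseqs0 inE; case: t => [|y t]; rewrite ?sub0seq ?andbF.
rewrite /= mem_cat IH; case: t => [|y t].
  by rewrite andbF orbF; apply/mapP => -[].
have [->|yx] := eqVneq y x.
  rewrite mem_map; last by move=> ? ? [].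
  rewrite IH /= eqSS; case: (_ == _); rewrite ?andbT ?andbF//.
  by apply/orb_idr => /cons_subseq.
rewrite [X in X || _](_ : _ = false)//.
by apply/mapP => -[z _ [yE _]]; rewrite yE eqxx in yx.
Qed.

Lemma uniq_subseqs k s : uniq s -> uniq (subseqs k s).
Proof.
elim: s k => [|x s IH] [|k]//= /andP[xs us].
rewrite cat_uniq map_inj_uniq ?IH//=; last by move=> ? ? [].
rewrite andbT; apply/hasPn => t; rewrite mem_subseqs => /andP[ts _].
apply/mapP => -[r _ tE]; move/negP: xs; apply.
by apply: (mem_subseq ts); rewrite tE mem_head.
Qed.

(** A set of k + 1 elements arises k + 1 times by adding an element to one of its subsets of size k;
    the invariance of f under permutations allows the added element to stand in front. *)
Lemma sum_subseqs_insert (R : pzRingType) (f : seq T -> R) k s : uniq s ->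
  (forall t t', size t = k.+1 -> perm_eq t t' -> f t = f t') ->
  \sum_(t <- subseqs k s) \sum_(x <- s | x \notin t) f (x :: t) =
  k.+1%:R * \sum_(t <- subseqs k.+1 s) f t.
Proof.
elim: s k f => [|x s IH] k f.
  by move=> _ _; rewrite /= !big_nil mulr0; case: k => [|k]; rewrite ?big_seq1 ?big_nil.
rewrite cons_uniq => /andP[xs us] fP.
rewrite [in RHS]sum_subseqsS mulrDr.
have Es t : x \notin t -> \sum_(y <- x :: s | y \notin t) f (y :: t) =
  f (x :: t) + \sum_(y <- s | y \notin t) f (y :: t).
  by move=> xt; rewrite big_cons xt.
have xt k' t : t \in subseqs k' s -> x \notin t.
  by rewrite mem_subseqs => /andP[ts _]; apply: contra xs => /(mem_subseq ts).
case: k fP => [|k] fP.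
  by rewrite -IH// !sum_subseqs0 Es// mul1r.
rewrite sum_subseqsS.
rewrite [X in _ + X](eq_big_seq (fun t => f (x :: t) + \sum_(y <- s | y \notin t) f (y :: t)));
  last first.
  by move=> t /xt; exact: Es.
rewrite big_split/= IH// addrA; congr (_ + _).
rewrite -natr1 mulrDl mul1r; congr (_ + _).
rewrite -(IH k (fun t => f (x :: t)))//; last first.
  by move=> t t' tk tt'; apply: fP; rewrite ?perm_cons//= tk.
apply: eq_big_seq => t tk; rewrite big_cons mem_head/=.
rewrite [RHS]big_seq_cond [LHS]big_seq_cond; apply: eq_big => [y|y _].
  case: (boolP (y \in s)) => //= ys; rewrite in_cons negb_or.
  by case: eqP => // yx; move: xs; rewrite -yx ys.
apply: fP; last by rewrite -[_ :: _ :: _]/([:: y] ++ [:: x] ++ t) perm_catCA.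
by move: tk; rewrite mem_subseqs => /andP[_ /eqP] /= ->.
Qed.

End subsequences_eqType.

(** Increasing tuples are the subsequences of the enumeration of the ordinals, since a strictly
    sorted list is determined by its elements. This links the inner sum of the theorem to [subseqs],
    where induction on the list is possible. *)
Lemma sum_sorted_tuples (V : nmodType) n k (f : seq 'I_n -> V) :
  \sum_(j : k.-tuple 'I_n | sorted (fun i i' : 'I_n => (i < i')%N) j) f j =
  \sum_(j <- subseqs k (enum 'I_n)) f j.
Proof.
pose ltI := (fun i i' : 'I_n => (i < i')%N).
have ltI_tr : transitive ltI by move=> i j l; exact: ltn_trans.
rewrite -big_filter -(big_map val xpredT f); apply: perm_big.
apply: uniq_perm.
- by rewrite map_inj_uniq ?filter_uniq ?index_enum_uniq//; exact: val_inj.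
- by rewrite uniq_subseqs// enum_uniq.
move=> s; rewrite mem_subseqs; apply/mapP/idP => [[t]|/andP[se /eqP sk]].
  rewrite mem_filter => /andP[st _] ->; rewrite size_tuple eqxx andbT.
  have us : uniq t by apply: (sorted_uniq ltI_tr) => // i; rewrite /ltI ltnn.
  rewrite (_ : val t = [seq i <- enum 'I_n | i \in t]) ?filter_subseq//.
  apply: (irr_sorted_eq ltI_tr) => //.
  - by move=> i; rewrite /ltI ltnn.
  - apply: sorted_filter => //.
    by have := iota_ltn_sorted 0 n; rewrite -val_enum_ord sorted_map.
  - by move=> i; rewrite mem_filter mem_enum andbT.
exists (tcast sk (in_tuple s)); last by rewrite /= val_tcast.
rewrite mem_filter mem_index_enum andbT /= val_tcast.
apply: (subseq_sorted ltI_tr se).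
by have := iota_ltn_sorted 0 n; rewrite -val_enum_ord sorted_map.
Qed.

(** * Measures on tuples *)

Section tuple_rectangles.
Context {d} {T : measurableType d} {R : realType}.

Definition rect n (B : 'I_n -> set T) : set (n.-tuple T) :=
  [set x | forall i, B i (tnth x i)].

Lemma measurable_rect n (B : 'I_n -> set T) :
  (forall i, measurable (B i)) -> measurable (rect B).
Proof.
move=> mB.
rewrite (_ : rect B = \bigcap_(i in [set: 'I_n]) ((@tnth n T)^~ i @^-1` B i)); last first.
  by apply/seteqP; split=> x /= xB i; [move=> _|]; exact: xB.
apply: fin_bigcap_measurable => // i _.
by rewrite -[X in measurable X]setTI; exact: measurable_tnth.
Qed.

(** Rectangles are stable under intersection, contain the whole space and generate the product
    sigma-field. *)
Lemma tuple_measure_unique n (m1 m2 : {measure set (n.-tuple T) -> \bar R}) :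
  (m1 setT < +oo)%E ->
  (forall B : 'I_n -> set T, (forall i, measurable (B i)) -> m1 (rect B) = m2 (rect B)) ->
  forall A, measurable A -> m1 A = m2 A.
Proof.
move=> m1oo m12.
pose G := [set rect B | B in [set B : 'I_n -> set T | forall i, measurable (B i)]].
have GT : G setT by exists (fun=> setT) => //; apply/seteqP; split.
apply: (measure_unique G (fun=> setT)) => //.
- apply/seteqP; split.
    apply: smallest_sub; first exact: smallest_sigma_algebra.
    rewrite -bigcup_seq/= => S [i _ [B mB <-]]; apply: sub_sigma_algebra.
    exists (fun j => if j == i then B else setT).
      by move=> j /=; case: ifP.
    apply/seteqP; split => x /=; first by move=> /(_ i); rewrite eqxx; split.
    by move=> [_ xB] j; case: eqP => // ->.
  apply: smallest_sub; first exact: sigma_algebra_measurable.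
  by move=> _ [B mB <-]; exact: measurable_rect.
- move=> _ _ [B mB <-] [C mC <-]; exists (fun i => B i `&` C i).
    by move=> i; exact: measurableI.
  apply/seteqP; split => x /=; first by move=> H; split => i; case: (H i).
  by move=> [xB xC] i; split.
- by apply/seteqP; split => // x _; exists 0%N.
- by move=> _ [B mB <-]; exact: m12.
Qed.

End tuple_rectangles.

Section power_measurable.
Context d d' (W : measurableType d') (T : measurableType d) {R : realType}.

Lemma prod_prob_rect n (mu : 'I_n -> probability T R) (B : 'I_n -> set T) :
  (forall i, measurable (B i)) ->
  prod_prob mu (rect B) = (\prod_(i < n) mu i (B i))%E.
Proof.
elim: n mu B => [|n IH] mu B mB.
  rewrite big_ord0 /= diracE mem_set//=.
  by case.
rewrite big_ord_recl /= /distribution /pushforward.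
rewrite (_ : _ @^-1` _ = B ord0 `*` rect (fun i => B (lift ord0 i))); last first.
  apply/seteqP; split => -[x y] /=.
    by move=> H; split; [have := H ord0|move=> i; have := H (lift ord0 i)]; rewrite ?tnth0 ?tnthS.
  move=> [xB yB] i; case: (unliftP ord0 i) => [j|] ->; by rewrite ?tnth0 ?tnthS.
rewrite product_measure1E//; last exact: measurable_rect.
congr (_ * _)%E; exact: IH.
Qed.

(** As a map into the Giry space, the power of order n + 1 is the Giry product of the measure with
    its power of order n, pushed forward by [tuple_cons]; each of these operations is measurable. *)
Lemma measurable_power_prob n (mu : W -> probability T R) :
  (forall C, measurable C -> measurable_fun setT (fun w => mu w C)) ->
  measurable_fun setT (fun w => power_prob (mu w) n : giry (n.-tuple T) R).
Proof.
move=> mmu; elim: n => [|n IH].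
  by apply: measurable_giry_codensity => // B mB; exact: measurable_cst.
have mmu' : measurable_fun setT (fun w => mu w : giry T R).
  exact: measurable_giry_codensity.
have : measurable_fun setT (giry_map (@measurable_tuple_cons _ T n) \o
   (giry_prod \o (fun w => (mu w : giry T R, power_prob (mu w) n : giry _ R)))).
  apply: measurableT_comp; first exact: measurable_giry_map.
  apply: measurableT_comp; first exact: measurable_giry_prod.
  exact: measurable_fun_pair.
move=> H; apply: measurable_giry_codensity => // B mB.
exact: (measurableT_comp (measurable_giry_ev mB) H).
Qed.

End power_measurable.

Section pair_unique.
Context {d} {T : measurableType d} {R : realType} (k n : nat).

Definition cat_pair (p : k.-tuple T * n.-tuple T) : (k + n).-tuple T := [tuple of p.1 ++ p.2].

Lemma measurable_cat_pair : measurable_fun setT cat_pair.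
Proof.
apply/measurable_fun_tnthP => i.
case: (split_ordP i) => j ->.
  rewrite (_ : _ \o _ = (@tnth k T)^~ j \o fst).
    by apply: measurableT_comp => //; exact: measurable_tnth.
  by apply/funext => -[x y] /=; rewrite tnth_lshift.
rewrite (_ : _ \o _ = (@tnth n T)^~ j \o snd).
  by apply: measurableT_comp => //; exact: measurable_tnth.
by apply/funext => -[x y] /=; rewrite tnth_rshift.
Qed.

HB.instance Definition _ :=
  isMeasurableFun.Build _ _ _ _ cat_pair measurable_cat_pair.

Definition split_pair (t : (k + n).-tuple T) : k.-tuple T * n.-tuple T :=
  ([tuple tnth t (lshift n i) | i < k], [tuple tnth t (rshift k i) | i < n]).

Lemma measurable_split_pair : measurable_fun setT split_pair.
Proof.
by apply: measurable_fun_pair; apply/measurable_fun_tnthP => i;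
  rewrite (_ : _ \o _ = (@tnth (k + n) T)^~ (lshift n i)) ||
  rewrite (_ : _ \o _ = (@tnth (k + n) T)^~ (rshift k i));
  try exact: measurable_tnth; apply/funext => t /=; rewrite tnth_mktuple.
Qed.

Lemma cat_pairK : cancel cat_pair split_pair.
Proof.
by move=> [x y]; congr pair; apply: eq_from_tnth => i;
  rewrite tnth_mktuple ?tnth_lshift ?tnth_rshift.
Qed.

(** Concatenation embeds pairs of tuples measurably into tuples of length k + n, with measurable
    left inverse [split_pair], and the preimage of a rectangle is a product of rectangles. *)
Lemma pair_measure_unique (m1 m2 : {measure set (k.-tuple T * n.-tuple T) -> \bar R}) :
  (m1 setT < +oo)%E ->
  (forall B C, (forall i, measurable (B i)) -> (forall i, measurable (C i)) ->
     m1 (rect B `*` rect C) = m2 (rect B `*` rect C)) ->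
  forall A, measurable A -> m1 A = m2 A.
Proof.
move=> m1oo m12 A mA.
have mS : measurable (split_pair @^-1` A).
  by rewrite -[X in measurable X]setTI; exact: measurable_split_pair.
suff : pushforward m1 cat_pair (split_pair @^-1` A) = pushforward m2 cat_pair (split_pair @^-1` A).
  rewrite /pushforward (_ : cat_pair @^-1` (split_pair @^-1` A) = A)//.
  by apply/seteqP; split => x /=; rewrite cat_pairK.
apply: tuple_measure_unique => // B mB; rewrite /= /pushforward.
rewrite (_ : _ @^-1` _ = rect (B \o lshift n) `*` rect (B \o @rshift k n)).
  by apply: m12 => i; exact: mB.
apply/seteqP; split => -[x y] /= H.
  by split=> i; [have := H (lshift n i)|have := H (rshift k i)];
    rewrite /cat_pair ?tnth_lshift ?tnth_rshift.
by move=> i; case: (split_ordP i) => j -> /=; rewrite /cat_pair ?tnth_lshift ?tnth_rshift; apply H.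
Qed.

End pair_unique.

(** * Real integrals and almost everywhere statements *)

Section integration.
Context {d} {T : measurableType d} {R : realType}.
Variable mu : {measure set T -> \bar R}.
Implicit Types f g : T -> R.

Lemma integrable_indicM f S : measurable S -> mu.-integrable setT (EFin \o f) ->
  mu.-integrable setT (EFin \o (fun x => \1_S x * f x)).
Proof.
move=> mS intf; have /measurable_EFinP mf := measurable_int _ intf.
apply: (le_integrable _ _ _ intf) => //.
  by apply/measurable_EFinP; apply: measurable_funM.
move=> x _ /=; rewrite lee_fin normrM ler_piMl//.
by rewrite indicE; case: (_ \in _); rewrite ?normr1 ?normr0.
Qed.

Lemma Rintegral_indic f S : measurable S ->
  \int[mu]_(x in S) f x = \int[mu]_x (\1_S x * f x).
Proof.
move=> mS; rewrite Rintegral_mkcond; apply: eq_Rintegral => x _.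
by rewrite patch_indic mulrC.
Qed.

Lemma Rintegral_sum (I : eqType) (s : seq I) (Q : pred I) (F : I -> T -> R) :
  (forall i, i \in s -> Q i -> mu.-integrable setT (EFin \o F i)) ->
  mu.-integrable setT (EFin \o (fun x => \sum_(i <- s | Q i) F i x)) /\
  \int[mu]_x (\sum_(i <- s | Q i) F i x) = \sum_(i <- s | Q i) \int[mu]_x F i x.
Proof.
elim: s => [|i s IH] intF.
  rewrite big_nil; under eq_fun do rewrite big_nil.
  split; first exact: integrable0.
  by rewrite /Rintegral integral0.
have [|intS IS] := IH.
  by move=> j js; apply: intF; rewrite in_cons js orbT.
rewrite big_cons; case: ifPn => Qi; last first.
  rewrite (_ : (fun x => _) = (fun x => \sum_(j <- s | Q j) F j x))//.
  by apply/funext => x; rewrite big_cons (negbTE Qi).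
rewrite (_ : (fun x => _) = (fun x => F i x + \sum_(j <- s | Q j) F j x)); last first.
  by apply/funext => x; rewrite big_cons Qi.
have intFi : mu.-integrable setT (EFin \o F i) by apply: intF; rewrite ?mem_head.
split; last by rewrite RintegralD// IS.
exact: (integrableD _ intFi intS).
Qed.

Lemma Rintegral_posneg f : mu.-integrable setT (EFin \o f) ->
  \int[mu]_x f x = \int[mu]_x f^\+ x - \int[mu]_x f^\- x.
Proof.
move=> intf; rewrite -RintegralB//.
- by apply: eq_Rintegral => x _; rewrite -[in LHS](funrposBneg f).
- exact: integrable_funrpos.
- exact: integrable_funrneg.
Qed.

Lemma ae_eq_Rintegral f g : measurable_fun setT g -> mu.-integrable setT (EFin \o f) ->
  {ae mu, forall x, f x = g x} ->
  mu.-integrable setT (EFin \o g) /\ \int[mu]_x f x = \int[mu]_x g x.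
Proof.
move=> mg intf fg; have mf := measurable_int _ intf.
have mEg : measurable_fun setT (EFin \o g) by exact/measurable_EFinP.
split.
  apply/integrableP; split => //; move/integrableP : intf => [_].
  rewrite (ae_eq_integral (fun x => `|(EFin \o g) x|)%E)//.
  - exact: measurableT_comp.
  - exact: measurableT_comp.
  - by apply: filterS fg => x /= ->.
by congr fine; apply: ae_eq_integral => //; apply: filterS fg => x /= ->.
Qed.

Lemma integrable_posnegP f :
  mu.-integrable setT (EFin \o f^\+) -> mu.-integrable setT (EFin \o f^\-) ->
  mu.-integrable setT (EFin \o f).
Proof.
move=> ip intn.
rewrite (_ : EFin \o f = (fun x => (EFin \o f^\+%R) x - (EFin \o f^\-%R) x)%E).
  exact: integrableB.
by apply/funext => x /=; rewrite -EFinB -[in LHS](funrposBneg f).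
Qed.

End integration.

Section Fubini_Rintegral.
Context {d1 d2} {T1 : measurableType d1} {T2 : measurableType d2} {R : realType}.
Variables (m1 : {sigma_finite_measure set T1 -> \bar R})
          (m2 : {sigma_finite_measure set T2 -> \bar R}).

(** The inner real integral is [fine] of an extended one, so it departs from the section integral
    where that one is infinite. Integrability confines this to a null set. *)
Lemma Fubini_Rintegral (f : T1 * T2 -> R) :
  (m1 \x m2)%E.-integrable setT (EFin \o f) ->
  m1.-integrable setT (EFin \o (fun x => \int[m2]_y f (x, y))) /\
  \int[(m1 \x m2)%E]_z f z = \int[m1]_x \int[m2]_y f (x, y).
Proof.
move=> intf; have intF := integrable_fubini_F intf.
have Ffin : ae_eq m1 setT (fubini_F m2 (EFin \o f)) (EFin \o (fun x => \int[m2]_y f (x, y))).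
  have := integrable_ae measurableT intF; apply: filterS => x /(_ I) Fx _.
  by rewrite /= /Rintegral fineK.
have mG : measurable_fun setT (EFin \o (fun x => \int[m2]_y f (x, y))).
  apply/measurable_EFinP; apply: measurableT_comp => //.
  exact: measurable_int intF.
split.
  apply: (le_integrable _ _ _ intF) => // x _ /=.
  rewrite /Rintegral -/(fubini_F m2 (EFin \o f) x).
  by case: (fubini_F _ _ x) => [r| |] /=; rewrite ?normr0 ?leey.
rewrite /Rintegral -integral12_prod_meas1//; congr fine.
by apply: ae_eq_integral => //; exact: measurable_int intF.
Qed.

Lemma measurable_Rintegral_section (f : T1 * T2 -> R) : measurable_fun setT f ->
  measurable_fun setT (fun x => \int[m2]_y f (x, y)).
Proof.
move=> mf; apply: measurableT_comp => //.
rewrite (_ : (fun x => _) = (fun x => fubini_F m2 (EFin \o f)^\+ x - fubini_F m2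
  (EFin \o f)^\- x)%E); last first.
  apply/funext => x; rewrite /fubini_F [LHS]integralE.
  by congr (_ - _)%E; apply: eq_integral => y _; rewrite ?funeposE ?funenegE.
have mEf : measurable_fun setT (EFin \o f) by exact/measurable_EFinP.
by apply: emeasurable_funB; apply: measurable_fun_fubini_tonelli_F => //;
  [exact: measurable_funepos|exact: measurable_funeneg].
Qed.

End Fubini_Rintegral.

Section distribution_ae.
Context {d d'} {W : measurableType d} {T : measurableType d'} {R : realType}.
Variable P : probability W R.

(** The uniqueness of conditional expectations given Y, phrased on the side of the law of Y: this is
    how identities tested on the events {Y in S} return to almost everywhere statements. *)
Lemma distribution_ae_eq0 (Y : {mfun W >-> T}) (f : T -> R) :
  measurable_fun setT f -> P.-integrable setT (EFin \o (f \o Y)) ->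
  (forall S, measurable S -> \int[P]_w (\1_S (Y w) * f (Y w)) = 0) ->
  {ae distribution P Y, forall u, f u = 0}.
Proof.
move=> mf intf f0.
have mEf : measurable_fun setT (EFin \o f) by exact/measurable_EFinP.
have intf' : (distribution P Y).-integrable setT (EFin \o f).
  by apply: integrable_pushforward => //; rewrite preimage_setT.
have : ae_eq (distribution P Y) setT (EFin \o f) (cst 0%E).
  apply: integral_ae_eq => // S _ mS.
  have mYS : measurable (Y @^-1` S) by rewrite -[X in measurable X]setTI; exact: measurable_funPT.
  have intYS : P.-integrable (Y @^-1` S) (EFin \o (f \o Y)) by apply: (integrableS _ _ _ intf).
  rewrite integral0 integral_pushforward//.
  have := f0 S mS; rewrite -[X in X = _ -> _](@Rintegral_indic _ _ _ _ _ (Y @^-1` S))//.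
  rewrite /Rintegral => /eqP; rewrite fine_eq0 => [/eqP//|].
  exact: integrable_fin_num.
by apply: filterS => u /(_ I) [].
Qed.

Lemma integrable_same_law (Y Y' : {mfun W >-> T}) (f : T -> R) : measurable_fun setT f ->
  (forall S, measurable S -> P (Y @^-1` S) = P (Y' @^-1` S)) ->
  P.-integrable setT (EFin \o (f \o Y)) -> P.-integrable setT (EFin \o (f \o Y')).
Proof.
move=> mf YY' /integrableP[_ Yoo]; apply/integrableP; split.
  by apply/measurable_EFinP; exact: measurableT_comp.
have mEf : measurable_fun setT (fun t => `|(f t)%:E|)%E.
  by apply/measurable_EFinP; exact: measurableT_comp.
move: Yoo; rewrite -(@ge0_integral_distribution _ _ _ _ _ P Y _ mEf)//.
rewrite -(@ge0_integral_distribution _ _ _ _ _ P Y' _ mEf)//.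
by rewrite (eq_measure_integral (distribution P Y'))// => S mS _; exact: YY'.
Qed.

Lemma distribution_ae (Y Y' : {mfun W >-> T}) (Q : T -> Prop) :
  (forall S, measurable S -> P (Y @^-1` S) = P (Y' @^-1` S)) ->
  {ae distribution P Y, forall u, Q u} -> {ae P, forall w, Q (Y' w)}.
Proof.
move=> YY' [N [mN PN QN]]; exists (Y' @^-1` N); split.
- by rewrite -[X in measurable X]setTI; exact: measurable_funPT.
- by rewrite -YY'.
- by move=> w /= nQ; apply: QN.
Qed.

End distribution_ae.

(** Hoelder's inequality against the constant 1, whose L^2 norm is 1 under a probability. *)
Lemma le_Rintegral_Lnorm2 (R : realType) d (T : measurableType d) (mu : probability T R) (E :
  set T) (f : T -> R) :
  measurable E -> mu.-integrable setT (EFin \o f) ->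
  (`|\int[mu]_w (\1_E w * f w)|%:E <= 'N[mu]_(2%:E)[EFin \o f])%E.
Proof.
move=> mE intf.
have intI := integrable_indicM mE intf.
have intaf : mu.-integrable setT (EFin \o (fun w => `|f w|)).
  by have := integrable_abse intf.
have intaI : mu.-integrable setT (EFin \o (fun w => `|\1_E w * f w|)).
  by have := integrable_abse intI.
have mf : measurable_fun setT f by have /measurable_EFinP := measurable_int _ intf.
have N1 : ('N[mu]_(1%:E)[EFin \o (f \* cst 1)%R] = (\int[mu]_w `|f w|)%:E)%E.
  rewrite Lnorm1 fineK; last exact: (integrable_fin_num measurableT intaf).
  by apply: eq_integral => w _; rewrite /= mulr1.
have : ('N[mu]_(1%:E)[EFin \o (f \* cst 1)%R] <= 'N[mu]_(2%:E)[EFin \o f] *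
  'N[mu]_(2%:E)[EFin \o cst 1%R])%E.
  by apply: hoelder => //; lra.
have -> : ('N[mu]_(2%:E)[EFin \o cst 1%R] = 1)%E.
  have muT : (mu setT `^ 2^-1 = 1)%E by rewrite [mu setT]probability_setT poweR_EFin powR1.
  by rewrite -muT; exact: Lnorm_cst1.
rewrite mule1 N1; apply: le_trans; rewrite lee_fin.
apply: (le_trans (le_normr_Rintegral measurableT intI)).
apply: le_Rintegral => // w _; rewrite normrM ler_piMl// indicE.
by case: (_ \in _); rewrite ?normr1 ?normr0.
Qed.

Lemma ae_all_seq (I : eqType) (R : realType) d (T : measurableType d) (mu : probability T R) (s :
  seq I) (Q : I -> T -> Prop) :
  (forall i, i \in s -> {ae mu, forall x, Q i x}) -> {ae mu, forall x i, i \in s -> Q i x}.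
Proof.
elim: s => [|i s IH] H; first by apply: aeW => x i.
have Hi := H i (mem_head _ _).
have Hs : {ae mu, forall x j, j \in s -> Q j x}.
  by apply: IH => j js; apply: H; rewrite inE js orbT.
by apply: filterS2 Hi Hs => x Hix Hsx j; rewrite inE => /predU1P[->|/Hsx].
Qed.

(** * The Polya sequence *)

Section polya.
Context {dO dA} {Omega : measurableType dO} {A : measurableType dA} {R : realType}.
Variables (P : probability Omega R) (alpha : {finite_measure set A -> \bar R}).
Variables (X : nat -> {mfun Omega >-> A}).

Let c := fine (alpha [set: A]).

Let c_ge0 : 0 <= c.
Proof. exact: fine_ge0. Qed.

Let rate_ge0 (n : nat) : 0 <= (c + n%:R)^-1.
Proof. by rewrite invr_ge0 addr_ge0. Qed.

(** [polya_predictive] is a bare set function; its version as a bundled measure gives access to the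
    integration theorems. *)
Definition predictive_measure (past : seq A) : {measure set A -> \bar R} :=
  mscale (NngNum (rate_ge0 (size past)))
    (measure_add alpha (msum (fun i => \d_(nth point past i)) (size past))).

Lemma predictive_measureE past : polya_predictive alpha past = predictive_measure past.
Proof.
apply/funext => B; rewrite /predictive_measure /= /mscale /polya_predictive muleC.
by rewrite /= /measure_add /msum !big_ord_recl big_ord0 adde0/= (big_nth point) big_mkord.
Qed.

Lemma integral_predictive past B (f : A -> \bar R) : measurable B ->
  measurable_fun B f -> (forall a, 0 <= f a)%E ->
  (\int[predictive_measure past]_(a in B) f a =
   (\int[alpha]_(a in B) f a + \sum_(p <- past) \d_p B * f p) * ((c + (size past)%:R)^-1)%:E)%E.
Proof.
move=> mB mf f0; rewrite /predictive_measure ge0_integral_mscale//= muleC.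
congr (_ * _)%E; rewrite ge0_integral_measure_add//; congr (_ + _)%E.
rewrite ge0_integral_measure_sum// (big_nth point) big_mkord; apply: eq_bigr => i _.
by rewrite integral_dirac.
Qed.

Definition measurable_seq (Bs : seq (set A)) := forall i, measurable (nth set0 Bs i).

Lemma measurable_rcons_tuple m :
  measurable_fun setT (fun p : m.-tuple A * A => [tuple of rcons p.1 p.2]).
Proof.
apply/measurable_fun_tnthP => i.
have [im|im] := ltnP i m.
  rewrite (_ : _ \o _ = (@tnth m A)^~ (Ordinal im) \o fst).
    by apply: measurableT_comp => //; exact: measurable_tnth.
  by apply/funext => -[x y] /=; rewrite !(tnth_nth y)/= nth_rcons size_tuple im.
rewrite (_ : _ \o _ = snd)//.
apply/funext => -[x y] /=; rewrite (tnth_nth y)/= nth_rcons size_tuple ltnNge im/=.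
by rewrite if_same.
Qed.

Lemma polya_rect_ge0 past Bs : (0 <= polya_rect alpha past Bs)%E.
Proof.
by elim: Bs past => [|B Bs IH] past//=; rewrite predictive_measureE; exact: integral_ge0.
Qed.

(** Measurability must be joint in the past and the next point, and each level of the recursion
    lengthens the past by one. Hence the past is a tuple, of a length m left free in the
    induction. *)
Lemma measurable_polya_rect Bs : measurable_seq Bs ->
  forall m, measurable_fun setT (fun t : m.-tuple A => polya_rect alpha t Bs).
Proof.
elim: Bs => [|B Bs IH] mBs m; first exact: measurable_cst.
have mB : measurable B := mBs 0%N.
have {}IH : forall m, measurable_fun setT (fun t : m.-tuple A => polya_rect alpha t Bs).
  by apply: IH => i; exact: (mBs i.+1).
have mr : measurable_fun setT (fun p : m.-tuple A * A => polya_rect alpha (rcons p.1 p.2) Bs).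
  exact: (measurableT_comp (IH m.+1) (@measurable_rcons_tuple m)).
have mr1 t : measurable_fun setT (fun a => polya_rect alpha (rcons t a) Bs).
  exact: (measurableT_comp (IH (size t).+1) (measurableT_comp (@measurable_rcons_tuple (size t))
    (@measurable_pair1 _ _ _ _ (in_tuple t)))).
rewrite (_ : (fun _ => _) = (fun t : m.-tuple A =>
   (\int[alpha]_a (polya_rect alpha (rcons t a) Bs * (\1_B a)%:E) +
    \sum_(i < m) \d_(tnth t i) B * polya_rect alpha (rcons t (tnth t i)) Bs) * ((c +
      m%:R)^-1)%:E)%E); last first.
  apply/funext => t /=; rewrite predictive_measureE integral_predictive//; last 2 first.
    by apply: measurable_funTS.
    by move=> a; exact: polya_rect_ge0.
  rewrite size_tuple big_tuple; congr ((_ + _) * _)%E.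
  by rewrite integral_mkcond; apply: eq_integral => a _; rewrite epatch_indic.
apply: emeasurable_funM => //; apply: emeasurable_funD.
  apply: (@measurable_fun_fubini_tonelli_F _ _ _ _ _ alpha (fun p : m.-tuple A * A =>
    polya_rect alpha (rcons p.1 p.2) Bs * (\1_B p.2)%:E)%E).
    apply: emeasurable_funM => //; apply/measurable_EFinP.
    by apply: measurableT_comp => //; exact: measurable_snd.
  by move=> p; rewrite mule_ge0 ?polya_rect_ge0// lee_fin.
apply: emeasurable_sum => i; apply: emeasurable_funM.
  rewrite (_ : (fun _ => _) = (EFin \o \1_B) \o (@tnth m A)^~ i)//.
  apply: measurableT_comp; last exact: measurable_tnth.
  exact/measurable_EFinP.
apply: (measurableT_comp mr (g := fun t => (t, tnth t i))).
by apply: measurable_fun_pair => //; exact: measurable_tnth.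
Qed.

Lemma measurable_polya_rect1 past Bs : measurable_seq Bs ->
  measurable_fun setT (fun a => polya_rect alpha (rcons past a) Bs).
Proof.
move=> mBs.
have := measurable_polya_rect mBs (m := (size past).+1).
move=> /measurableT_comp /(_ (measurableT_comp (@measurable_rcons_tuple (size past))
  (@measurable_pair1 _ _ _ _ (in_tuple past)))).
by [].
Qed.

(** The last observation is either drawn from alpha, or repeats a point of the past, or repeats the
    l-th of the observations in between, which then has to lie in the intersection of its own set
    with C. As [polya_rect] peels sets off from the front, the last one is reached by induction with
    an arbitrary past. *)
Lemma polya_rect_rcons past Bs C : 0 < c -> measurable C -> measurable_seq Bs ->
  (polya_rect alpha past (rcons Bs C) * (c + (size past + size Bs)%:R)%:E =
   (alpha C + \sum_(p <- past) \d_p C) * polya_rect alpha past Bs +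
   \sum_(l < size Bs) polya_rect alpha past (set_nth set0 Bs l (nth set0 Bs l `&` C)))%E.
Proof.
move=> c0 mC; elim: Bs past => [|B Bs IH] past mBs.
  rewrite /= big_ord0 adde0 mule1 predictive_measureE integral_cst// mul1e -predictive_measureE.
  rewrite /polya_predictive -muleA addn0 -EFinM mulVf ?mule1//.
  by rewrite gt_eqF// ltr_wpDr.
have mB : measurable B := mBs 0%N.
have mBs' : measurable_seq Bs by move=> i; exact: (mBs i.+1).
have mBsl l : measurable_seq (set_nth set0 Bs l (nth set0 Bs l `&` C)).
  by move=> i; rewrite nth_set_nth /=; case: eqP => // _; exact: measurableI.
have r0 past' : (0 <= alpha C + \sum_(p <- past') \d_p C)%E.
  by rewrite adde_ge0// sume_ge0.
rewrite big_ord_recl rcons_cons [X in (X * _)%E]/= [X in _ = (_ * X + _)%E]/= predictive_measureE.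
rewrite muleC -ge0_integralZl//; last 3 first.
- by apply: measurable_funTS; apply: measurable_polya_rect1 => i; rewrite nth_rcons;
  case: ifP => // _; case: ifP.
- by move=> a _; exact: polya_rect_ge0.
- by rewrite lee_fin addr_ge0.
transitivity (\int[predictive_measure past]_(a in B)
   (((alpha C + \sum_(p <- past) \d_p C) * polya_rect alpha (rcons past a) Bs +
    \d_a C * polya_rect alpha (rcons past a) Bs) +
      \sum_(l < size Bs) polya_rect alpha (rcons past a) (set_nth set0 Bs l
        (nth set0 Bs l `&` C))))%E.
  apply: eq_integral => a _; rewrite muleC.
  have -> : (size past + size (B :: Bs) = size (rcons past a) + size Bs)%N.
    by rewrite size_rcons /= addnS.
  rewrite IH// -cats1 big_cat big_seq1/= addeA ge0_muleDl//.
have mR Bs' : measurable_seq Bs' -> measurable_fun B (fun a => polya_rect alpha (rcons past a) Bs').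
  by move=> ?; apply: measurable_funTS; exact: measurable_polya_rect1.
have md : measurable_fun B (fun a => \d_a C : \bar R)%E.
  by apply: measurable_funTS; apply/measurable_EFinP.
rewrite ge0_integralD//; last 4 first.
- by move=> a _; rewrite adde_ge0// mule_ge0// polya_rect_ge0.
- by apply: emeasurable_funD; apply: emeasurable_funM => //; exact: mR.
- by move=> a _; apply: sume_ge0 => l _; exact: polya_rect_ge0.
- by apply: emeasurable_sum => l; exact: mR.
rewrite ge0_integralD//; last 4 first.
- by move=> a _; rewrite mule_ge0// polya_rect_ge0.
- by apply: emeasurable_funM => //; exact: mR.
- by move=> a _; rewrite mule_ge0// polya_rect_ge0.
- by apply: emeasurable_funM => //; exact: mR.
rewrite -addeA; congr (_ + (_ + _))%E.
- rewrite ge0_integralZl//; first exact: mR.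
  by move=> a _; exact: polya_rect_ge0.
(* The atom at the point just drawn restricts its set B to the part inside C: this is the term l =
   0. *)
- rewrite /= predictive_measureE integral_mkcondr; apply: eq_integral => a _.
  by rewrite epatch_indic muleC.
rewrite ge0_integral_sum//; last 2 first.
- by move=> l; exact: mR.
- by move=> l a _; exact: polya_rect_ge0.
by apply: eq_bigr => l _; rewrite /= predictive_measureE.
Qed.

(** * Laws of vectors of observations and Polya's predictive rule *)

Hypothesis alpha_gt0 : 0 < c.
Hypothesis X_polya : polya_sequence P alpha X.

Lemma polya_prob s Bs : sorted ltn s -> size s = size Bs -> measurable_seq Bs ->
  P [set w | forall i, (i < size Bs)%N -> nth set0 Bs i (X (nth 0%N s i) w)] =
  polya_rect alpha [::] Bs.
Proof.
move=> ss sB mBs.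
have sB' : size s == size Bs by exact/eqP.
rewrite -(X_polya (k := size Bs) (j := Tuple sB') (B := in_tuple Bs))//; last first.
  by move=> i; rewrite (tnth_nth set0)/=; exact: mBs.
congr (P _); apply/seteqP; split => w /= H.
  by move=> i; have := H i (ltn_ord i); rewrite (tnth_nth set0) (tnth_nth 0%N).
by move=> i iB; have := H (Ordinal iB); rewrite (tnth_nth set0) (tnth_nth 0%N).
Qed.

Definition Xat m (s : m.-tuple nat) (w : Omega) : m.-tuple A :=
  [tuple X (tnth s i) w | i < m].

Lemma measurable_Xat m (s : m.-tuple nat) : measurable_fun setT (Xat s).
Proof.
apply/measurable_fun_tnthP => i.
have -> : (fun t => tnth t i) \o Xat s = X (tnth s i); last exact: measurable_funPT.
by apply/funext => w /=; rewrite tnth_mktuple.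
Qed.

HB.instance Definition _ m (s : m.-tuple nat) :=
  isMeasurableFun.Build _ _ _ _ (Xat s) (measurable_Xat s).

Definition seq_of_sets m (B : 'I_m -> set A) : seq (set A) := [tuple B i | i < m].

Lemma size_seq_of_sets m (B : 'I_m -> set A) : size (seq_of_sets B) = m.
Proof. by rewrite size_tuple. Qed.

Lemma nth_seq_of_sets m (B : 'I_m -> set A) (i : 'I_m) : nth set0 (seq_of_sets B) i = B i.
Proof. by rewrite -(tnth_nth set0 [tuple B i | i < m]) tnth_mktuple. Qed.

Lemma measurable_seq_of_sets m (B : 'I_m -> set A) :
  (forall i, measurable (B i)) -> measurable_seq (seq_of_sets B).
Proof.
move=> mB i; have [im|mi] := ltnP i m; first by rewrite (nth_seq_of_sets B (Ordinal im)).
by rewrite nth_default ?size_seq_of_sets.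
Qed.

Lemma Xat_rect m (s : m.-tuple nat) (B : 'I_m -> set A) : sorted ltn s ->
  (forall i, measurable (B i)) ->
  P (Xat s @^-1` rect B) = polya_rect alpha [::] (seq_of_sets B).
Proof.
move=> ss mB; rewrite -(@polya_prob s)//; last 2 first.
- by rewrite size_seq_of_sets size_tuple.
- exact: measurable_seq_of_sets.
congr (P _); apply/seteqP; split => w /= H i.
  rewrite size_seq_of_sets => im; have := H (Ordinal im).
  by rewrite tnth_mktuple -nth_seq_of_sets (tnth_nth 0%N).
have := H i; rewrite size_seq_of_sets ltn_ord => /(_ isT).
by rewrite nth_seq_of_sets tnth_mktuple (tnth_nth 0%N).
Qed.

Lemma XvecE m : Xvec X m = Xat (iota_tuple m 0).
Proof.
apply/funext => w; apply: eq_from_tnth => i.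
by rewrite !tnth_mktuple (tnth_nth 0%N)/= nth_iota.
Qed.

(** Polya's formula for rectangles does not see the indices, provided that they increase. *)
Lemma polya_law m (s : m.-tuple nat) S : sorted ltn s -> measurable S ->
  P (Xat s @^-1` S) = P (Xvec X m @^-1` S).
Proof.
move=> ss mS.
apply: (@tuple_measure_unique _ _ _ _ (pushforward P (Xat s)) (pushforward P (Xvec X m))) => //.
  by rewrite /= /pushforward preimage_setT probability_setT ltry.
move=> B mB; rewrite /= /pushforward Xat_rect// XvecE Xat_rect//.
by rewrite /= iota_ltn_sorted.
Qed.

(** For l = m the point in front is a new observation, for l < m it repeats one of the m old ones;
    [acons] puts there a free point, to be integrated against alpha. These are the three kinds of
    terms in Polya's rule. *)
Definition Xcons m l (w : Omega) : m.+1.-tuple A := tuple_cons (X l w, Xvec X m w).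

Lemma measurable_Xcons m l : measurable_fun setT (Xcons m l).
Proof.
apply: (measurableT_comp (@measurable_tuple_cons _ _ m)).
by apply: measurable_fun_pair => //; exact: measurable_Xvec.
Qed.

HB.instance Definition _ m l :=
  isMeasurableFun.Build _ _ _ _ (Xcons m l) (@measurable_Xcons m l).

Definition acons m (p : Omega * A) : m.+1.-tuple A := tuple_cons (p.2, Xvec X m p.1).

Lemma measurable_acons m : measurable_fun setT (acons m).
Proof.
apply: (measurableT_comp (@measurable_tuple_cons _ _ m)).
apply: measurable_fun_pair => //; apply: measurableT_comp => //; exact: measurable_Xvec.
Qed.

HB.instance Definition _ m :=
  isMeasurableFun.Build _ _ _ _ (acons m) (@measurable_acons m).

Lemma tuple_cons_rect m (B : 'I_m.+1 -> set A) a (x : m.-tuple A) :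
  rect B (tuple_cons (a, x)) <-> B ord0 a /\ rect (fun i => B (lift ord0 i)) x.
Proof.
split => [H|[xB yB] i].
  by split; [have := H ord0|move=> i; have := H (lift ord0 i)]; rewrite ?tnth0 ?tnthS.
by case: (unliftP ord0 i) => [j|] ->; rewrite ?tnth0 ?tnthS.
Qed.

Let cm_ge0 (m : nat) : 0 <= c + m%:R.
Proof. by rewrite addr_ge0. Qed.

Lemma Xcons_rect_new m (B : 'I_m.+1 -> set A) : (forall i, measurable (B i)) ->
  P (Xcons m m @^-1` rect B) =
  polya_rect alpha [::] (rcons (seq_of_sets (fun i => B (lift ord0 i))) (B ord0)).
Proof.
move=> mB; set Bs := seq_of_sets _.
rewrite -(@polya_prob (iota 0 m.+1)); last 3 first.
- exact: iota_ltn_sorted.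
- by rewrite size_iota size_rcons size_seq_of_sets.
- move=> i; rewrite nth_rcons; case: ifP => _; last by case: ifP.
  by apply: measurable_seq_of_sets => j.
congr (P _); apply/seteqP; split => w.
  move=> /tuple_cons_rect[H0 H1] i; rewrite size_rcons size_seq_of_sets => im.
  rewrite nth_iota ?ltnS// nth_rcons size_seq_of_sets; have [im'|mi] := ltnP i m.
    have := H1 (Ordinal im'); rewrite tnth_mktuple.
    by rewrite /Bs (nth_seq_of_sets (fun i => B (lift ord0 i)) (Ordinal im')).
  by have -> : i = m by [apply/eqP; rewrite eqn_leq mi andbT -ltnS]; rewrite eqxx.
move=> H; apply/tuple_cons_rect; split.
  have := H m; rewrite size_rcons size_seq_of_sets ltnSn => /(_ isT).
  by rewrite nth_iota// nth_rcons size_seq_of_sets ltnn eqxx.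
move=> i; have := H i; rewrite size_rcons size_seq_of_sets ltnS (ltnW (ltn_ord i)) => /(_ isT).
by rewrite nth_iota ?ltnS 1?ltnW// nth_rcons size_seq_of_sets ltn_ord /Bs nth_seq_of_sets
  tnth_mktuple.
Qed.

Lemma Xcons_rect_old m l (B : 'I_m.+1 -> set A) : (forall i, measurable (B i)) -> (l < m)%N ->
  P (Xcons m l @^-1` rect B) =
  polya_rect alpha [::] (set_nth set0 (seq_of_sets (fun i => B (lift ord0 i))) l
    (nth set0 (seq_of_sets (fun i => B (lift ord0 i))) l `&` B ord0)).
Proof.
move=> mB lm; set Bs := seq_of_sets _.
have mBs : measurable_seq Bs by apply: measurable_seq_of_sets => j.
have sBs : size (set_nth set0 Bs l (nth set0 Bs l `&` B ord0)) = m.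
  by rewrite size_set_nth size_seq_of_sets; apply/maxn_idPr.
rewrite -(@polya_prob (iota 0 m)); last 3 first.
- exact: iota_ltn_sorted.
- by rewrite size_iota sBs.
- by move=> i; rewrite nth_set_nth/=; case: eqP => // _; exact: measurableI.
congr (P _); apply/seteqP; split => w /=.
  move=> /tuple_cons_rect[H0 H1] i; rewrite sBs => im; rewrite nth_iota// nth_set_nth/=.
  have : nth set0 Bs i (X i w).
    have := H1 (Ordinal im); rewrite tnth_mktuple.
    by rewrite /Bs (nth_seq_of_sets (fun i => B (lift ord0 i)) (Ordinal im)).
  by case: eqP => // -> ?; split.
move=> H; apply/tuple_cons_rect; split.
  have := H l; rewrite sBs => /(_ lm); rewrite nth_iota// nth_set_nth/= eqxx => -[//].
move=> i; have := H i; rewrite sBs => /(_ (ltn_ord i)); rewrite nth_iota// nth_set_nth/=.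
rewrite tnth_mktuple; have [<-|_] := eqVneq (i : nat) l; last by rewrite /Bs nth_seq_of_sets.
by rewrite /Bs nth_seq_of_sets => -[].
Qed.

(** On rectangles this is [polya_rect_rcons] with an empty past. Both sides are measures in S and
    the left one is finite, so the identity extends to all measurable sets. *)
Lemma polya_prediction m S : measurable S ->
  ((c + m%:R)%:E * P (Xcons m m @^-1` S) =
   (P \x alpha) (acons m @^-1` S) + \sum_(l < m) P (Xcons m l @^-1` S))%E.
Proof.
move=> mS.
pose m1 : {measure set _ -> \bar R} := mscale (NngNum (cm_ge0 m)) (distribution P (Xcons m m)).
pose nu : {measure set _ -> \bar R} := pushforward (P \x alpha)%E (acons m).
pose m2 : {measure set _ -> \bar R} := measure_add (nu (@measurable_acons m)) (msum (fun l =>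
  distribution P (Xcons m l)) m).
have m1E S' : m1 S' = ((c + m%:R)%:E * P (Xcons m m @^-1` S'))%E by [].
have m2E S' : m2 S' = ((P \x alpha) (acons m @^-1` S') + \sum_(l < m) P (Xcons m l @^-1` S'))%E.
  by rewrite /m2 /= /measure_add /msum /= !big_ord_recl big_ord0 adde0.
rewrite -m1E -m2E; apply: tuple_measure_unique => //.
  by rewrite m1E preimage_setT probability_setT mule1 ltry.
move=> B mB; rewrite m1E m2E.
rewrite Xcons_rect_new// muleC.
have := @polya_rect_rcons [::] (seq_of_sets (fun i =>
  B (lift ord0 i))) (B ord0) alpha_gt0 (mB ord0).
rewrite add0n size_seq_of_sets => ->; last by apply: measurable_seq_of_sets => j.
rewrite big_nil adde0; congr (_ + _)%E; last first.
  by apply: eq_bigr => l _; rewrite Xcons_rect_old.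
rewrite (_ : _ @^-1` _ = (Xvec X m @^-1` rect (fun i => B (lift ord0 i))) `*` B ord0); last first.
  by apply/seteqP; split => -[w a] /= => [/tuple_cons_rect[]//|[? ?]]; apply/tuple_cons_rect.
rewrite product_measure1E//; last first.
  by rewrite -[X in measurable X]setTI; apply: measurable_Xvec => //; apply: measurable_rect => i.
rewrite muleC; congr (_ * _)%E; rewrite XvecE; apply/esym.
by apply: (@Xat_rect m (iota_tuple m 0) (fun i => B (lift ord0 i))) => //; exact: iota_ltn_sorted.
Qed.

Lemma polya_prediction_ge0 m (f : m.+1.-tuple A -> \bar R) :
  measurable_fun setT f -> (forall t, 0 <= f t)%E ->
  ((c + m%:R)%:E * \int[P]_w f (Xcons m m w) =
   \int[P \x alpha]_p f (acons m p) + \sum_(l < m) \int[P]_w f (Xcons m l w))%E.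
Proof.
move=> mf f0.
pose m1 : {measure set _ -> \bar R} := mscale (NngNum (cm_ge0 m)) (distribution P (Xcons m m)).
pose nu : {measure set _ -> \bar R} := pushforward (P \x alpha)%E (acons m).
pose m2 : {measure set _ -> \bar R} := measure_add (nu (@measurable_acons m)) (msum (fun l =>
  distribution P (Xcons m l)) m).
have m2E S' : m2 S' = ((P \x alpha) (acons m @^-1` S') + \sum_(l < m) P (Xcons m l @^-1` S'))%E.
  by rewrite /m2 /= /measure_add /msum /= !big_ord_recl big_ord0 adde0.
have m12 S : measurable S -> S `<=` setT -> m1 S = m2 S.
  by move=> mS _; rewrite m2E -polya_prediction.
transitivity (\int[m1]_t f t)%E.
  by rewrite ge0_integral_mscale// ge0_integral_distribution.
rewrite (eq_measure_integral m2)// ge0_integral_measure_add//; congr (_ + _)%E.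
  by rewrite ge0_integral_pushforward.
rewrite ge0_integral_measure_sum//; apply: eq_bigr => l _.
by rewrite ge0_integral_distribution.
Qed.

(** Integrability is assumed at a new observation only. For f >= 0 the terms on the right are
    nonnegative with a finite sum, so each of them is finite; positive and negative parts then give
    the general case. *)
Lemma polya_prediction_Rintegral m (f : m.+1.-tuple A -> R) :
  measurable_fun setT f -> P.-integrable setT (EFin \o (f \o Xcons m m)) ->
  [/\ forall l, (l < m)%N -> P.-integrable setT (EFin \o (f \o Xcons m l)),
      (P \x alpha)%E.-integrable setT (EFin \o (f \o acons m)) &
      (c + m%:R) * \int[P]_w f (Xcons m m w) =
      \int[(P \x alpha)%E]_p f (acons m p) + \sum_(0 <= l < m) \int[P]_w f (Xcons m l w)].
Proof.
have ge0 (p : m.+1.-tuple A -> R) : measurable_fun setT p -> (forall t, 0 <= p t) ->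
  P.-integrable setT (EFin \o (p \o Xcons m m)) ->
  [/\ forall l, (l < m)%N -> P.-integrable setT (EFin \o (p \o Xcons m l)),
      (P \x alpha)%E.-integrable setT (EFin \o (p \o acons m)) &
      (c + m%:R) * \int[P]_w p (Xcons m m w) =
      \int[(P \x alpha)%E]_t p (acons m t) + \sum_(0 <= l < m) \int[P]_w p (Xcons m l w)].
  move=> mp p0 intp.
  have mEp : measurable_fun setT (EFin \o p) by exact/measurable_EFinP.
  have := polya_prediction_ge0 mEp (fun t => p0 t).
  have finL : ((c + m%:R)%:E * \int[P]_w (p (Xcons m m w))%:E \is a fin_num)%E.
    by rewrite fin_numM// integrable_fin_num.
  have I0 l : (0 <= \int[P]_w (p (Xcons m l w))%:E)%E.
    by apply: integral_ge0 => w _; rewrite lee_fin.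
  have J0 : (0 <= \int[P \x alpha]_t (p (acons m t))%:E)%E.
    by apply: integral_ge0 => w _; rewrite lee_fin.
  move=> E; have := finL; rewrite E.
  have S0 : (0 <= \sum_(l < m) \int[P]_w (p (Xcons m l w))%:E)%E by exact: sume_ge0.
  rewrite ge0_fin_numE; last exact: adde_ge0 J0 S0.
  move=> Hlt.
  have Jlt : (\int[P \x alpha]_t (p (acons m t))%:E < +oo)%E.
    by apply: le_lt_trans Hlt; exact: leeDl S0.
  have Ilt (l : 'I_m) : (\int[P]_w (p (Xcons m l w))%:E < +oo)%E.
    apply: le_lt_trans Hlt; apply: (le_trans _ (leeDr _ J0)).
    by rewrite (bigD1 l)//=; apply: leeDl; exact: sume_ge0.
  have intA : (P \x alpha)%E.-integrable setT (EFin \o (p \o acons m)).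
    apply/integrableP; split.
      by apply/measurable_EFinP/measurableT_comp => //; exact: measurable_acons.
    by under eq_integral do rewrite /= ger0_norm//.
  have intl l : (l < m)%N -> P.-integrable setT (EFin \o (p \o Xcons m l)).
    move=> lm; apply/integrableP; split.
      by apply/measurable_EFinP/measurableT_comp => //; exact: measurable_Xcons.
    by under eq_integral do rewrite /= ger0_norm//; exact: (Ilt (Ordinal lm)).
  split => //.
  have Jfin : (\int[P \x alpha]_t (EFin \o p) (acons m t))%E \is a fin_num.
    exact: (integrable_fin_num _ intA).
  have Ifin (l : 'I_m) : (\int[P]_w (EFin \o p) (Xcons m l w))%E \is a fin_num.
    by apply: (integrable_fin_num _ (intl l _)).
  have Sfin : (\sum_(l < m) \int[P]_w (EFin \o p) (Xcons m l w))%E \is a fin_num.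
    by rewrite (ge0_fin_numE S0); apply: le_lt_trans Hlt; exact: leeDr J0.
  have mfin : (\int[P]_w (EFin \o p) (Xcons m m w))%E \is a fin_num.
    exact: (integrable_fin_num _ intp).
  move: E => /(congr1 fine); rewrite (fineM _ mfin)// (fineD Jfin Sfin).
  move=> E; rewrite [LHS]E; congr (_ + _).
  by rewrite -sum_fine// big_mkord.
move=> mf intf.
have [Ip Jp Ep] := ge0 f^\+ (measurable_funrpos mf) (funrpos_ge0 f)
  (integrable_funrpos measurableT intf).
have [In Jn En] := ge0 f^\- (measurable_funrneg mf) (funrneg_ge0 f)
  (integrable_funrneg measurableT intf).
have intl l : (l < m)%N -> P.-integrable setT (EFin \o (f \o Xcons m l)).
  by move=> lm; apply: integrable_posnegP; [exact: Ip|exact: In].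
have intA : (P \x alpha)%E.-integrable setT (EFin \o (f \o acons m)).
  by apply: integrable_posnegP; [exact: Jp|exact: Jn].
split => //.
rewrite (Rintegral_posneg intf) mulrBr Ep En (Rintegral_posneg intA) opprD addrACA; congr (_ + _).
rewrite -sumrB; apply: eq_big_nat => l /andP[_ lm].
by rewrite (Rintegral_posneg (intl l lm)).
Qed.

(** * Degenerate symmetric kernels *)

Lemma measurable_nth_tuple m j : measurable_fun setT (fun t : m.-tuple A => nth point t j).
Proof.
have [jm|mj] := ltnP j m.
  rewrite (_ : (fun _ => _) = (@tnth m A)^~ (Ordinal jm)); first exact: measurable_tnth.
  by apply/funext => t; rewrite (tnth_nth point).
rewrite (_ : (fun _ => _) = cst point)//; apply/funext => t.
by rewrite nth_default// size_tuple.
Qed.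

Lemma measurable_select m n (idx : 'I_n -> nat) :
  measurable_fun setT (fun t : m.-tuple A => [tuple nth point t (idx i) | i < n]).
Proof.
apply/measurable_fun_tnthP => i.
rewrite (_ : _ \o _ = fun t : m.-tuple A => nth point t (idx i)); first exact: measurable_nth_tuple.
by apply/funext => t /=; rewrite tnth_mktuple.
Qed.

(** Kernels act on tuples, whereas the combinatorics runs on lists whose length equals n only by
    proof. The default [point] is read only when the list is shorter than n. *)
Definition on_seq n (h : n.-tuple A -> R) (b : seq A) : R := h [tuple nth point b i | i < n].

Lemma on_seq_tuple n (h : n.-tuple A -> R) (t : n.-tuple A) : on_seq h t = h t.
Proof.
by congr h; apply: eq_from_tnth => i; rewrite tnth_mktuple (tnth_nth point).
Qed.

Definition Xseq (s : seq nat) (w : Omega) : seq A := [seq X l w | l <- s].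

Lemma Xseq_Xat m (s : m.-tuple nat) w : Xseq s w = Xat s w.
Proof. by rewrite /Xseq -[in LHS](map_tnth_enum s) -map_comp. Qed.

Section symmetric_kernel.
Variables (q : nat) (h : q.+1.-tuple A -> R).
Hypothesis h_Xi : Xi P X h.

Let h_sym : forall (s : {perm 'I_q.+1}) (a : q.+1.-tuple A), h [tuple tnth a (s i) | i < q.+1] =
  h a.
Proof. by case: h_Xi. Qed.

Let mh : measurable_fun setT h.
Proof. by case: h_Xi. Qed.

Lemma on_seq_perm b b' : perm_eq b b' -> size b = q.+1 -> on_seq h b = on_seq h b'.
Proof.
move=> bb' sb; have sb' : size b' = q.+1 by rewrite -(perm_size bb').
rewrite -[b]/(tval (Tuple (introT eqP sb))) -[b']/(tval (Tuple (introT eqP sb'))) !on_seq_tuple.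
have /tuple_permP[s Es] : perm_eq (Tuple (introT eqP sb)) (Tuple (introT eqP sb')) by [].
by rewrite -[RHS](h_sym s); congr h; apply: val_inj; exact: Es.
Qed.

Lemma Xi_integrable : P.-integrable setT (EFin \o (h \o Xvec X q.+1)).
Proof.
case: h_Xi => _ _ h2 _.
have mhX : measurable_fun setT (h \o Xvec X q.+1).
  by apply: measurableT_comp => //; exact: measurable_Xvec.
(* Integrability follows from the second moment by |y| <= y^2 + 1. *)
have int2 : P.-integrable setT (EFin \o (fun w => h (Xvec X q.+1 w) ^+ 2 + 1)).
  apply/integrableP; split.
    apply/measurable_EFinP; apply: measurable_funD => //.
    exact: measurable_funX.
  under eq_integral.
    move=> w _; rewrite /= ger0_norm ?addr_ge0 ?sqr_ge0// EFinD.
    over.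
  rewrite ge0_integralD//=; last 2 first.
  - by move=> w _; rewrite lee_fin sqr_ge0.
  - by apply/measurable_EFinP; exact: measurable_funX.
  rewrite lte_add_pinfty//; first by move: h2; rewrite unlock.
  have -> : (\int[P]__ 1 = 1)%E by rewrite integral_cst// mul1e; exact: probability_setT.
  exact: ltry.
apply: (le_integrable _ _ _ int2) => //; first exact/measurable_EFinP.
move=> w _ /=; rewrite lee_fin [leRHS]ger0_norm ?addr_ge0 ?sqr_ge0//.
set y := h _; rewrite -real_normK ?num_real//; have := normr_ge0 y; nra.
Qed.

(** Sorting the indices leaves the kernel unchanged by symmetry, and increasing indices give the law
    of the first observations. *)
Lemma Xi_integrable_on_seq s : uniq s -> size s = q.+1 ->
  P.-integrable setT (EFin \o (fun w => on_seq h (Xseq s w))).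
Proof.
move=> us ss.
have st : size (sort leq s) == q.+1 by rewrite size_sort ss.
pose t := Tuple st.
have tsort : sorted ltn t by rewrite ltn_sorted_uniq_leq sort_uniq us sort_sorted//;
  exact: leq_total.
rewrite (_ : (fun w => _) = h \o Xat t).
  apply: (integrable_same_law (Y := Xvec X q.+1)) => //; last exact: Xi_integrable.
  by move=> S mS; rewrite polya_law.
apply/funext => w; rewrite /= -on_seq_tuple -Xseq_Xat; apply: on_seq_perm.
  by apply: perm_map; rewrite perm_sym perm_sort.
by rewrite size_map.
Qed.

(* Polya's rule makes this [c + q] times the mean of [h] at [q] old points and one
   new one, so that degeneracy of [h] trades integration against alpha for a sum
   over the old points. *)
Definition predictive_mean (u : q.-tuple A) : R :=
  \int[alpha]_a h (tuple_cons (a, u)) + \sum_(0 <= i < q) on_seq h (nth point u i :: u).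

Lemma on_seq_cons a (u : q.-tuple A) : on_seq h (a :: u) = h (tuple_cons (a, u)).
Proof. by rewrite -on_seq_tuple. Qed.

Lemma measurable_alpha_mean : measurable_fun setT (fun u : q.-tuple A =>
  \int[alpha]_a h (tuple_cons (a, u))).
Proof.
have := @measurable_Rintegral_section _ _ _ _ _ alpha (fun p : q.-tuple A * A =>
  h (tuple_cons (p.2, p.1))).
apply.
apply: measurableT_comp => //.
apply: (measurableT_comp (@measurable_tuple_cons _ _ q)).
exact: measurable_fun_pair.
Qed.

Lemma measurable_predictive_mean : measurable_fun setT predictive_mean.
Proof.
apply: measurable_funD; first exact: measurable_alpha_mean.
apply: measurable_sum => i.
rewrite (_ : (fun u => _) = h \o (@tuple_cons _ A q) \o (fun u : q.-tuple A => (nth point u i, u))).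
  apply: measurableT_comp.
    by apply: measurableT_comp => //; exact: measurable_tuple_cons.
  by apply: measurable_fun_pair => //; exact: measurable_nth_tuple.
by apply/funext => u /=; rewrite on_seq_cons.
Qed.

(** By Polya's rule, [predictive_mean] at the first q observations is c + q times the conditional
    mean of h given them, and degeneracy says that this mean is zero. *)
Lemma predictive_mean_eq0 : {ae distribution P (Xvec X q), forall u, predictive_mean u = 0}.
Proof.
have hX w : h (Xcons q q w) = h (Xvec X q.+1 w).
  rewrite -!on_seq_tuple XvecE -Xseq_Xat; apply: on_seq_perm; last by rewrite size_tuple.
  rewrite -[tval (Xcons q q w)]/(X q w :: Xvec X q w) XvecE -Xseq_Xat.
  rewrite -[X q w :: _]/(Xseq (q :: iota 0 q) w) -[tval (iota_tuple _ _)]/(iota 0 q.+1).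
  by apply: perm_map; rewrite -addn1 iotaD /= perm_sym cats1 perm_rcons.
(* With the indicator that the tail lies in S as a factor, the prediction rule becomes an identity
   of integrals over the event {X^q in S}, the form in which degeneracy is given. *)
pose f S (t : q.+1.-tuple A) : R := \1_S [tuple of behead t] * h t.
have mf S : measurable S -> measurable_fun setT (f S).
  move=> mS; apply: measurable_funM => //.
  by apply: measurableT_comp => //; exact: measurable_behead.
have fX S l w : f S (Xcons q l w) = \1_S (Xvec X q w) * h (Xcons q l w).
  by congr (\1_S _ * _); exact: val_inj.
have fa S w a : f S (acons q (w, a)) = \1_S (Xvec X q w) * h (tuple_cons (a, Xvec X q w)).
  by congr (\1_S _ * _); exact: val_inj.
have mXS S : measurable S -> measurable (Xvec X q @^-1` S).
  by move=> mS; rewrite -[X in measurable X]setTI; exact: measurable_Xvec.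
have intX : P.-integrable setT (EFin \o (h \o Xcons q q)).
  by rewrite (_ : h \o _ = h \o Xvec X q.+1); [exact: Xi_integrable|apply/funext => w /=].
have intf S : measurable S -> P.-integrable setT (EFin \o (f S \o Xcons q q)).
  move=> mS; rewrite (_ : f S \o _ = (fun w => \1_(Xvec X q @^-1` S) w * (h \o Xcons q q) w)).
    by apply: integrable_indicM => //; exact: mXS.
  by apply/funext => w; rewrite /= fX.
have [Il IA _] := polya_prediction_Rintegral mh intX.
have [IAf EA] := Fubini_Rintegral IA.
have oX w i : on_seq h (nth point (Xvec X q w) i :: Xvec X q w) = h (Xcons q i w) \/ (q <= i)%N.
  have [iq|] := ltnP i q; [left|by right].
  rewrite on_seq_cons; congr (h (tuple_cons (_, _))).
  by rewrite -(tnth_nth _ _ (Ordinal iq)) tnth_mktuple.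
have intsumS S : measurable S -> P.-integrable setT (EFin \o (fun w =>
  \sum_(0 <= i < q) \1_S (Xvec X q w) * h (Xcons q i w))).
  move=> mS; apply: (Rintegral_sum (F := fun i w => \1_S (Xvec X q w) * h (Xcons q i w)) _).1 => i.
  rewrite mem_index_iota => /andP[_ iq] _.
  by apply: (integrable_indicM (mXS S mS)); exact: Il.
have intsum : P.-integrable setT (EFin \o (fun w => \sum_(0 <= i < q) h (Xcons q i w))) /\
   forall S, measurable S -> \int[P]_w (\sum_(0 <= i < q) \1_S (Xvec X q w) * h (Xcons q i w)) =
     \sum_(0 <= i < q) \int[P]_w (\1_S (Xvec X q w) * h (Xcons q i w)).
  split.
    by apply: (Rintegral_sum (F := fun i w => h (Xcons q i w)) _).1 => i;
      rewrite mem_index_iota => /andP[_ iq] _; exact: Il.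
  move=> S mS; apply: (Rintegral_sum (F := fun i w =>
    \1_S (Xvec X q w) * h (Xcons q i w)) _).2 => i.
  rewrite mem_index_iota => /andP[_ iq] _.
  by apply: (integrable_indicM (mXS S mS)); exact: Il.
have pmX : predictive_mean \o Xvec X q = (fun w =>
  \int[alpha]_a h (acons q (w, a)) + \sum_(0 <= i < q) h (Xcons q i w)).
  apply/funext => w; congr (_ + _); apply: eq_big_nat => i /andP[_ iq].
  by case: (oX w i) => //; rewrite leqNgt iq.
apply: distribution_ae_eq0.
- exact: measurable_predictive_mean.
- rewrite pmX; exact: (integrableD _ IAf intsum.1).
move=> S mS.
have [_ IAS] := polya_prediction_Rintegral (mf S mS) (intf S mS).
have -> : \int[P]_w f S (Xcons q q w) = 0.
  rewrite (eq_Rintegral P (g := fun w => \1_(Xvec X q @^-1` S) w * h (Xvec X q.+1 w))); last first.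
    by move=> w _; rewrite fX hX.
  rewrite -Rintegral_indic; last exact: mXS.
  have [_ _ _ [_ _ /(_ S mS)]] := h_Xi.
  rewrite integral0 => /(congr1 fine)/= E; by rewrite /Rintegral -E.
rewrite mulr0 => /esym E.
rewrite (eq_Rintegral P (g := fun w => \int[alpha]_a f S (acons q (w, a)) +
  \sum_(0 <= i < q) \1_S (Xvec X q w) * h (Xcons q i w))); last first.
  move=> w _.
  have -> : predictive_mean (Xvec X q w) = \int[alpha]_a h (acons q (w, a)) +
    \sum_(0 <= i < q) h (Xcons q i w) by rewrite -[LHS]/((predictive_mean \o Xvec X q) w) pmX.
  rewrite mulrDr mulr_sumr; congr (_ + _).
  under [RHS]eq_Rintegral do rewrite fa.
  rewrite indicE; case: (_ \in _); last by rewrite mul0r;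
    under [RHS]eq_Rintegral do rewrite mul0r; rewrite /Rintegral integral0.
  by rewrite mul1r; under [RHS]eq_Rintegral do rewrite mul1r.
have [IAfS EAS] := Fubini_Rintegral IAS.
rewrite RintegralD//; last exact: intsumS.
rewrite -EAS intsum.2// -[RHS]E; congr (_ + _); apply: eq_big_nat => i _.
by apply: eq_Rintegral => w _; rewrite fX.
Qed.

(** * Moving observations from the future to the past *)

Section increment.
Variables (k : nat) (B : set (k.-tuple A)).
Hypothesis mB : measurable B.

Let W (s : seq nat) : R := \int[P]_w (\1_B (Xvec X k w) * on_seq h (Xseq s w)).

(** Polya's rule is applied to the observation of index m with all m earlier ones as its past,
    although h sees only those in s. The terms that repeat an observation of s, together with the
    integral against alpha, make up [predictive_mean] at these observations, which vanishes almost
    surely; the indices outside s remain. The indicator of B may stay inside because k <= m makes it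
    a function of that past. *)
Lemma on_seq_increment m s : sorted ltn s -> size s = q -> all (fun i =>
  (i < m)%N) s -> (k <= m)%N ->
  (c + m%:R) * W (m :: s) = \sum_(0 <= l < m | l \notin s) W (l :: s).
Proof.
move=> ss sq sm km.
have us : uniq s by apply: (sorted_uniq ltn_trans ltnn).
(* In [Xcons m l] position 0 holds the added point, so the observation of index i stands at position
   i + 1. *)
pose idx (i : 'I_q.+1) := nth 0%N (0%N :: map S s) i.
pose f (t : m.+1.-tuple A) : R :=
  \1_B [tuple nth point t i.+1 | i < k] * h [tuple nth point t (idx i) | i < q.+1].
have mf : measurable_fun setT f.
  apply: measurable_funM.
    by apply: measurableT_comp => //; exact: measurable_select.
  by apply: measurableT_comp => //; exact: measurable_select.
have nX w i : (i < m)%N -> nth point (Xvec X m w) i = X i w.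
  by move=> im; rewrite -(tnth_nth _ _ (Ordinal im)) tnth_mktuple.
have fa a w : f (tuple_cons (a, Xvec X m w)) = \1_B (Xvec X k w) * on_seq h (a :: Xseq s w).
  congr (\1_B _ * h _); apply: eq_from_tnth => i; rewrite !tnth_mktuple.
    by rewrite -[nth _ _ _]/(nth point (Xvec X m w) i) nX// (leq_trans _ km).
  case: (unliftP ord0 i) => [j|] ->; rewrite /idx//=.
  have js : (j < size s)%N by rewrite sq.
  rewrite (nth_map 0%N)// -[nth _ (_ :: _) _.+1]/(nth point (Xvec X m w) (nth 0%N s j)).
  by rewrite nX ?(nth_map 0%N)//; exact: (allP sm) (mem_nth _ js).
pose t := Tuple (introT eqP sq).
have XsE w : Xseq s w = Xat t w by rewrite -Xseq_Xat.
(* [predictive_mean_eq0] speaks of the first q observations; equality of laws carries it to those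
   with indices in s. *)
have aeX : {ae P, forall w, predictive_mean (Xat t w) = 0}.
  apply: (distribution_ae (Y := Xvec X q) (Y' := Xat t) (Q := fun u => predictive_mean u = 0));
    last exact: predictive_mean_eq0.
  by move=> S mS; rewrite polya_law.
have mXB : measurable (Xvec X k @^-1` B).
  by rewrite -[X in measurable X]setTI; exact: measurable_Xvec.
have fXl l : f \o Xcons m l = (fun w => \1_B (Xvec X k w) * on_seq h (Xseq (l :: s) w)).
  by apply/funext => w; rewrite /= fa.
have intf : P.-integrable setT (EFin \o (f \o Xcons m m)).
  rewrite fXl; apply: (integrable_indicM mXB); apply: Xi_integrable_on_seq => /=.
    by rewrite us andbT; apply/negP => /(allP sm); rewrite ltnn.
  by rewrite sq.
have [Il IA E] := polya_prediction_Rintegral mf intf.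
have [IAf EA] := Fubini_Rintegral IA.
have EW l : \int[P]_w f (Xcons m l w) = W (l :: s).
  by apply: eq_Rintegral => w _; rewrite -[LHS]/((f \o Xcons m l) w) fXl.
have iW l : (l < m)%N -> P.-integrable setT (EFin \o (fun w =>
  \1_B (Xvec X k w) * on_seq h (Xseq (l :: s) w))).
  by move=> /Il; rewrite fXl.
move: E; rewrite EW (eq_bigr (fun l => W (l :: s))) => [E|l _]; last exact: EW.
rewrite E (bigID (fun l => l \in s))/= addrA -[RHS]add0r; congr (_ + _).
have sumE F : \sum_(0 <= l < m | l \in s) F l = \sum_(l <- s) F l :> R.
  rewrite -big_filter; apply: perm_big; apply: uniq_perm => //.
    by rewrite filter_uniq// iota_uniq.
  move=> l; rewrite mem_filter mem_index_iota /=; case: (boolP (l \in s)) => //= ls.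
  by rewrite (allP sm).
have [iS ES] := Rintegral_sum (s := s) (Q := xpredT) (F := fun l w =>
  \1_B (Xvec X k w) * on_seq h (Xseq (l :: s) w))
   (fun l ls _ => iW l (allP sm l ls)).
rewrite sumE -ES EA -RintegralD//.
rewrite /Rintegral (ae_eq_integral (cst 0%E))//.
- by rewrite integral0.
- exact: measurable_int (integrableD _ IAf iS).
apply: filterS aeX => w + _ /=; move=> Ew; congr EFin.
transitivity (\1_B (Xvec X k w) * predictive_mean (Xat t w)); last by rewrite Ew mulr0.
rewrite /predictive_mean mulrDr mulr_sumr; congr (_ + _).
  transitivity (\int[alpha]_a (\1_B (Xvec X k w) * h (tuple_cons (a, Xat t w)))).
    apply: eq_Rintegral => a _.
    by rewrite -[LHS]/(f (tuple_cons (a, Xvec X m w))) fa XsE on_seq_cons.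
  rewrite indicE; case: (_ \in _); last by rewrite mul0r; under eq_Rintegral do rewrite mul0r;
    rewrite /Rintegral integral0.
  by rewrite mul1r; under eq_Rintegral do rewrite mul1r.
rewrite (big_nth 0%N) sq; apply: eq_big_nat => i /andP[_ iq].
congr (_ * on_seq h _); rewrite -XsE /=; congr (_ :: _).
by rewrite (nth_map 0%N)// sq.
Qed.

Lemma W_perm s s' : perm_eq s s' -> size s = q.+1 -> W s = W s'.
Proof.
move=> ss' sq; apply: eq_Rintegral => w _; congr (_ * _).
by apply: on_seq_perm; rewrite ?size_map//; exact: perm_map.
Qed.

(* [r] of the [q.+1] observations come after time [k], the others range over the
   past; each step moves one of them from the future to the past. *)
Let V r : R := \sum_(L <- subseqs (q.+1 - r) (iota 0 k)) W (L ++ iota k r).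

(** The latest future observation, of index k + r, plays the new one in [on_seq_increment]. The
    indices that may replace it are those of the past outside L, and inserting them into all L
    yields each larger subset q + 1 - r times. *)
Lemma V_step r : (r <= q)%N -> (c + (k + r)%:R) * V r.+1 = (q.+1 - r)%:R * V r.
Proof.
move=> rq; rewrite /V (subSn rq) subSS mulr_sumr -sum_subseqs_insert ?iota_uniq//; last first.
  move=> t t' tq tt'; apply: W_perm; first by rewrite perm_cat2r.
  by rewrite size_cat tq size_iota addSn subnK.
apply: eq_big_seq => L; rewrite mem_subseqs => /andP[Lk /eqP sL].
have Llt : all (fun i => (i < k)%N) L.
  by apply/allP => i /(mem_subseq Lk); rewrite mem_iota.
have sLq : size (L ++ iota k r) = q by rewrite size_cat sL size_iota subnK.
have sLr : sorted ltn (L ++ iota k r).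
  have := iota_ltn_sorted 0 (k + r); rewrite iotaD add0n => kr.
  by apply: (subseq_sorted ltn_trans _ kr); rewrite cat_subseq.
have Lkr : all (fun i => (i < k + r)%N) (L ++ iota k r).
  rewrite all_cat; apply/andP; split; last by apply/allP => i; rewrite mem_iota => /andP[].
  by apply: sub_all Llt => i ik; rewrite ltn_addr.
rewrite (_ : W (L ++ iota k r.+1) = W ((k + r)%N :: L ++ iota k r)); last first.
  apply: W_perm; last by rewrite size_cat size_iota sL addnS subnK.
  by rewrite -addn1 iotaD catA cats1 perm_rcons.
rewrite on_seq_increment ?leq_addr// /index_iota subn0 iotaD big_cat/=.
rewrite [X in _ + X]big_seq_cond [X in _ + X]big1 ?addr0; last first.
  by move=> l; rewrite add0n mem_cat negb_or => /andP[lk /andP[_]]; rewrite lk.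
rewrite big_seq_cond [RHS]big_seq_cond; apply: eq_bigl => l.
rewrite mem_cat negb_or mem_iota add0n; case: (ltnP l k) => //= lk.
by rewrite mem_iota (leqNgt k) lk /= andbT.
Qed.

(** In q + 1 applications of [V_step] the left factors multiply to the rising factorial and the
    right ones to (q + 1)!. For k <= q the past has no subset of size q + 1 and the integral is
    zero. *)
Lemma future_block_integral :
  W (iota k q.+1) = q.+1`!%:R / rising (c + k%:R) q.+1 *
    \sum_(L <- subseqs q.+1 (iota 0 k)) W L.
Proof.
have r0 r : rising (c + k%:R) r != 0 by rewrite gt_eqF// rising_gt0// ltr_wpDr.
have VE r : (r <= q.+1)%N -> rising (c + k%:R) r * V r = (q.+1 ^_ r)%:R * V 0.
  elim: r => [|r IH] rq; first by rewrite rising0 ffactn0.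
  rewrite risingSr -addrA -natrD -mulrA V_step// mulrCA IH 1?ltnW//.
  by rewrite ffactnSr natrM mulrCA mulrA.
have := VE q.+1 (leqnn _); rewrite ffactnn {1}/V subnn sum_subseqs0 cat0s => E.
apply: (mulfI (r0 q.+1)); rewrite E mulrA mulrCA mulfV// mulr1 /V subn0; congr (_ * _).
by apply: eq_bigr => L _; rewrite cats0.
Qed.

End increment.

End symmetric_kernel.

(** * The directing measure *)

Section directing_measure.
Variable D : Omega -> probability A R.
Hypothesis D_meas : random_probability D.
Hypothesis D_lim : empirical_limit P X D.

Let fineD_ge0 w C : 0 <= fine (D w C).
Proof. exact: fine_ge0. Qed.

Let fineD_le1 w C : measurable C -> fine (D w C) <= 1.
Proof.
by move=> mC; rewrite -lee_fin fineK ?fin_num_measure// probability_le1.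
Qed.

Let measurable_fineD C : measurable C -> measurable_fun setT (fun w => fine (D w C)).
Proof. by move=> mC; apply: measurableT_comp => //; exact: D_meas. Qed.

Let prodD (Cs : seq (set A)) w : R := \prod_(C <- Cs) fine (D w C).

Let measurable_prodD Cs : measurable_seq Cs -> measurable_fun setT (prodD Cs).
Proof.
elim: Cs => [|C Cs IH] mCs.
  by rewrite (_ : prodD _ = cst 1)//; apply/funext => w; rewrite /prodD big_nil.
rewrite (_ : prodD _ = (fun w => fine (D w C) * prodD Cs w)); last first.
  by apply/funext => w; rewrite /prodD big_cons.
apply: measurable_funM; first exact: measurable_fineD (mCs 0%N).
by apply: IH => i; exact: (mCs i.+1).
Qed.

Let prodD_ge0 Cs w : 0 <= prodD Cs w.
Proof. by rewrite /prodD; apply: prodr_ge0. Qed.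

Let prodD_le1 Cs w : measurable_seq Cs -> prodD Cs w <= 1.
Proof.
rewrite /prodD; elim: Cs => [|C Cs IH] mCs; first by rewrite big_nil.
rewrite big_cons mulr_ile1//; first by rewrite prodr_ge0.
  exact: fineD_le1 (mCs 0%N).
by apply: IH => i; exact: (mCs i.+1).
Qed.

Let cylinder s (Bs : seq (set A)) : set Omega :=
  [set w | forall i, (i < size Bs)%N -> nth set0 Bs i (X (nth 0%N s i) w)].

Let cylinder_rcons s Bs r C : size s = size Bs ->
  cylinder (rcons s r) (rcons Bs C) = cylinder s Bs `&` X r @^-1` C.
Proof.
move=> sB; apply/seteqP; split => w /=.
  move=> H; split => [i iB|].
    by have := H i; rewrite size_rcons !nth_rcons sB iB => /(_ (ltnW iB)).
  by have := H (size Bs); rewrite size_rcons !nth_rcons sB ltnn eqxx => /(_ (ltnSn _)).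
move=> [H Hr] i; rewrite size_rcons ltnS leq_eqVlt => /orP[/eqP ->|iB].
  by rewrite !nth_rcons sB ltnn eqxx.
by rewrite !nth_rcons sB iB; exact: H.
Qed.

Let measurable_cylinder s Bs : measurable_seq Bs -> measurable (cylinder s Bs).
Proof.
move=> mBs.
rewrite (_ : cylinder s Bs = \bigcap_(i in [set i | (i < size Bs)%N]) (X
  (nth 0%N s i) @^-1` nth set0 Bs i)); last first.
  by apply/seteqP; split => w /=.
apply: fin_bigcap_measurable; first exact: finite_II.
by move=> i _; rewrite -[X in measurable X]setTI; exact: measurable_funPT.
Qed.

(* One factor [D(C)] at a time is replaced by the empirical measures; all but
   finitely many of the indices [r] lie beyond the indices already used, so that
   the Cesaro means have a constant tail. *)
Lemma cylinder_integral Cs : measurable_seq Cs -> forall s Bs, sorted ltn s ->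
  size s = size Bs -> measurable_seq Bs ->
  \int[P]_w (\1_(cylinder s Bs) w * prodD Cs w) = fine (polya_rect alpha [::] (Bs ++ Cs)).
Proof.
elim: Cs => [|C Cs IH] mCs s Bs ss sB mBs.
  rewrite cats0 -(polya_prob ss sB mBs) -/(cylinder s Bs) /Rintegral.
  rewrite -[in RHS](setIT (cylinder s Bs)) -integral_indic//; last exact: measurable_cylinder.
  by congr fine; apply: eq_integral => w _; rewrite /prodD big_nil mulr1.
have mC : measurable C := mCs 0%N.
have {}mCs : measurable_seq Cs by move=> i; exact: (mCs i.+1).
have mcyl := measurable_cylinder s mBs.
pose a r := \int[P]_w (\1_(cylinder s Bs) w * prodD Cs w * \1_C (X r w)).
have aE r : all (fun i => (i < r)%N) s -> a r = fine (polya_rect alpha [::] (Bs ++ C :: Cs)).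
  move=> sr; rewrite -cat_rcons -(IH mCs (rcons s r)); last 3 first.
  - by rewrite (sorted_pairwise ltn_trans) pairwise_rcons -(sorted_pairwise ltn_trans) ss andbT.
  - by rewrite !size_rcons sB.
  - by move=> i; rewrite nth_rcons; case: ifP => // _; case: ifP.
  apply: eq_Rintegral => w _; rewrite cylinder_rcons// indicI /= mulrAC.
  by [].
have a_cvg : a @ \oo --> fine (polya_rect alpha [::] (Bs ++ C :: Cs)).
  apply: cvg_near_cst; exists (\max_(i <- s) i).+1 => // r /= sr.
  rewrite aE//; apply/allP => i si; apply: leq_trans sr; rewrite ltnS.
  by rewrite (big_rem i)//= leq_maxl.
have mean_cvg := cesaro a_cvg.
pose f_ M w := \1_(cylinder s Bs) w * prodD Cs w * (M.+1%:R^-1 * \sum_(0 <= r < M.+1) \1_C (X r w)).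
pose f w := \1_(cylinder s Bs) w * prodD Cs w * fine (D w C).
have m1 : measurable_fun setT (fun w => \1_(cylinder s Bs) w * prodD Cs w).
  by apply: measurable_funM => //; exact: measurable_prodD.
have m1X r : measurable_fun setT (fun w => \1_C (X r w) : R).
  by apply: measurableT_comp => //.
have mf_ M : measurable_fun setT (f_ M).
  apply: measurable_funM => //; apply: measurable_funM => //.
  by apply: measurable_sum => r.
have mf : measurable_fun setT f by apply: measurable_funM => //; exact: measurable_fineD.
have le1 w : `|\1_(cylinder s Bs) w * prodD Cs w| <= 1.
  rewrite normrM mulr_ile1// ger0_norm ?prodD_ge0 ?prodD_le1//.
have f_le M w : `|f_ M w| <= 1.
  rewrite normrM mulr_ile1// ger0_norm; last by rewrite mulr_ge0// sumr_ge0.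
  rewrite mulrC ler_pdivrMr ?ltr0n// mul1r.
  rewrite big_mkord (le_trans (ler_sum _ (G := fun=> 1) _))//.
  by rewrite sumr_const card_ord.
have f_cvg : {ae P, forall w, setT w -> (EFin \o f_ ^~ w) @ \oo --> (EFin \o f) w}.
  have := D_lim mC; apply: filterS => w Dw _.
  apply: cvg_EFin; first exact: nearW.
  apply: cvgMr.
  (* The M-th Cesaro mean averages M + 1 terms, whereas the n-th empirical measure averages n. *)
  move: Dw; rewrite -(cvg_shiftS (fun n => n%:R^-1 * \sum_(i < n) \1_C (X i w) : R)) /=.
  by under eq_fun do rewrite -(big_mkord xpredT (fun i => \1_C (X i w))).
have int1 : P.-integrable setT (EFin \o cst (1 : R)).
  exact: finite_measure_integrable_cst.
have [intf _ If] := @dominated_convergence _ _ _ P setT measurableT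
  (fun M => EFin \o f_ M) (EFin \o f) (EFin \o cst 1)
  (fun M => (measurable_EFinP _ _).2 (mf_ M)) ((measurable_EFinP _ _).2 mf)
  f_cvg int1 (aeW _ (fun w M _ => f_le M w)).
have J : (\int[P]_w (EFin \o f) w = (\int[P]_w f w)%:E)%E.
  by rewrite fineK//; exact: integrable_fin_num intf.
have f_E M : (\int[P]_w (EFin \o f_ M) w = (arithmetic_mean a M)%:E)%E.
  have int_a r : P.-integrable setT (EFin \o (fun w =>
    \1_(cylinder s Bs) w * prodD Cs w * \1_C (X r w))).
    apply: (le_integrable _ _ _ int1) => //.
      by apply/measurable_EFinP; exact: measurable_funM.
    move=> w _; rewrite /= lee_fin normr1 normrM mulr_ile1// indicE.
    by case: (_ \in _); rewrite ?normr1 ?normr0.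
  have [int_s Es] := Rintegral_sum (s := index_iota 0 M.+1) (Q := xpredT) (fun r _ _ => int_a r).
  rewrite -[RHS]/((M.+1%:R^-1 * \sum_(0 <= r < M.+1) a r)%:E) -Es.
  rewrite -RintegralZl// fineK.
    by apply: eq_integral => w _; rewrite /= /f_ -mulr_sumr mulrCA.
  by apply: integrable_fin_num => //; exact: (integrableZl _ _ int_s).
rewrite (eq_Rintegral P (g := f)); last first.
  by move=> w _; rewrite /f /prodD big_cons -!mulrA [fine _ * _]mulrC.
move: If; rewrite J; under eq_fun do rewrite f_E.
move=> /fine_cvg If; exact: cvg_unique If mean_cvg.
Qed.

(** * Joint law of the past and of a sample from D *)

Section joint_law.
Variables k n : nat.

(** A kernel in the Giry monad: a Dirac mass freezes the past while n further points are drawn from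
    D. Its average over P is [joint]. *)
Let past_sample (w : Omega) : giry (k.-tuple A * n.-tuple A)%type R :=
  giry_prod (giry_ret (Xvec X k w), (power_prob (D w) n : giry (n.-tuple A) R)).

Let measurable_past_sample : measurable_fun setT past_sample.
Proof.
apply: (measurableT_comp measurable_giry_prod); apply: measurable_fun_pair.
  by apply: measurableT_comp; [exact: measurable_giry_ret|exact: measurable_Xvec].
exact: measurable_power_prob.
Qed.

Let joint : giry (k.-tuple A * n.-tuple A)%type R :=
  giry_bind (P : giry Omega R) measurable_past_sample.

Definition Xpair (w : Omega) := (Xvec X k w, Xat (iota_tuple n k) w).

Lemma measurable_Xpair : measurable_fun setT Xpair.
Proof. by apply: measurable_fun_pair; [exact: measurable_Xvec|exact: measurable_Xat]. Qed.

HB.instance Definition _ := isMeasurableFun.Build _ _ _ _ Xpair measurable_Xpair.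

(** The conditional i.i.d. property in integrated form. Both measures give a product of rectangles
    the value [polya_rect]: the right one by Polya's formula for the first k + n observations, the
    left one by [cylinder_integral]. *)
Lemma joint_law S : measurable S -> joint S = distribution P Xpair S.
Proof.
move=> mS.
apply: (@pair_measure_unique _ _ _ _ _ joint (distribution P Xpair)) => //.
  have H := @sprobability_setT _ _ _ joint.
  exact: (le_lt_trans H (ltry _)).
move=> B C mB mC.
have mBC : measurable (rect B `*` rect C) by apply: measurableX; exact: measurable_rect.
transitivity (giry_int joint (EFin \o \1_(rect B `*` rect C))).
  by rewrite /giry_int integral_indic// setIT.
have mind : measurable_fun setT (EFin \o \1_(rect B `*` rect C) :
  k.-tuple A * n.-tuple A -> \bar R).
  exact/measurable_EFinP.
rewrite giry_int_bind//; last by move=> x; rewrite lee_fin.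
have XE : distribution P Xpair (rect B `*` rect C) =
  polya_rect alpha [::] (seq_of_sets B ++ seq_of_sets C).
  rewrite -(@polya_prob (iota 0 (k + n))); last 3 first.
  - exact: iota_ltn_sorted.
  - by rewrite size_iota size_cat !size_seq_of_sets.
  - move=> i; rewrite nth_cat; case: ifP => _; exact: measurable_seq_of_sets.
  congr (P _); apply/seteqP; split => w /=.
    move=> [HB HC] i; rewrite size_cat !size_seq_of_sets => ikn.
    rewrite nth_iota// nth_cat size_seq_of_sets; case: ltnP => ik.
      by have := HB (Ordinal ik); rewrite tnth_mktuple (nth_seq_of_sets B (Ordinal ik)).
    have ikn' : (i - k < n)%N by rewrite ltn_subLR.
    have := HC (Ordinal ikn'); rewrite tnth_mktuple (nth_seq_of_sets C (Ordinal ikn')).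
    by rewrite (tnth_nth 0%N)/= nth_iota// subnKC.
  move=> H; split => i; rewrite tnth_mktuple.
    have := H i; rewrite size_cat !size_seq_of_sets ltn_addr// => /(_ isT).
    by rewrite nth_iota ?ltn_addr// nth_cat size_seq_of_sets ltn_ord nth_seq_of_sets.
  have := H (k + i)%N; rewrite size_cat !size_seq_of_sets ltn_add2l ltn_ord => /(_ isT).
  rewrite nth_iota ?ltn_add2l// nth_cat size_seq_of_sets ltnNge leq_addr/= addKn nth_seq_of_sets.
  by rewrite (tnth_nth 0%N)/= nth_iota.
have := @cylinder_integral (seq_of_sets C) (measurable_seq_of_sets mC) (iota 0 k) (seq_of_sets B)
  (iota_ltn_sorted 0 k) _ (measurable_seq_of_sets mB).
rewrite size_iota size_seq_of_sets => /(_ erefl) E1.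
have {}XE : distribution P Xpair (rect B `*` rect C) =
  (fine (polya_rect alpha [::] (seq_of_sets B ++ seq_of_sets C)))%:E.
  by rewrite -XE fineK// fin_num_measure.
apply: (eq_trans _ (esym XE)); rewrite -E1 /Rintegral.
have cylE : cylinder (iota 0 k) (seq_of_sets B) = Xvec X k @^-1` rect B.
  apply/seteqP; split => w /= H i.
    rewrite tnth_mktuple; have := H i; rewrite size_seq_of_sets ltn_ord => /(_ isT).
    by rewrite nth_seq_of_sets nth_iota.
  rewrite size_seq_of_sets => ik; have := H (Ordinal ik).
  by rewrite tnth_mktuple nth_iota// -[i]/(val (Ordinal ik)) nth_seq_of_sets.
have mE : measurable (Xvec X k @^-1` rect B).
  by rewrite -cylE; apply: measurable_cylinder; exact: measurable_seq_of_sets.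
rewrite fineK; last first.
  apply: integrable_fin_num => //.
  apply: (@integrable_indicM _ _ _ P (prodD (seq_of_sets C))).
    by rewrite cylE.
  have int1 : P.-integrable setT (EFin \o cst (1 : R)) by exact: finite_measure_integrable_cst.
  apply: (le_integrable _ _ _ int1) => //.
    by apply/measurable_EFinP; apply: measurable_prodD; exact: measurable_seq_of_sets.
  move=> w _; rewrite /= lee_fin normr1 ger0_norm//.
  by apply: prodD_le1; exact: measurable_seq_of_sets.
apply: eq_integral => w _.
rewrite /giry_int integral_indic// setIT cylE.
transitivity (giry_ret (Xvec X k w) (rect B) * power_prob (D w) n (rect C))%E.
  by apply: product_measure1E; exact: measurable_rect.
rewrite prod_prob_rect// EFinM; congr (_ * _)%E.
rewrite /prodD big_map -[RHS]/(EFin _) -big_enum/= .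
rewrite (big_morph EFin EFinM erefl); apply: eq_bigr => i _.
by rewrite fineK// fin_num_measure.
Qed.

Lemma integral_joint (f : k.-tuple A * n.-tuple A -> \bar R) : measurable_fun setT f ->
  (forall p, 0 <= f p)%E ->
  (\int[P]_w \int[power_prob (D w) n]_y f (Xvec X k w, y) = \int[P]_w f (Xpair w))%E.
Proof.
move=> mf f0.
transitivity (giry_int joint f).
  rewrite giry_int_bind//; apply: eq_integral => w _.
  rewrite giry_int_prod1// giry_int_ret//.
  apply: (@measurable_fun_fubini_tonelli_F _ _ _ _ _ (power_prob (D w) n) f) => //.
transitivity (\int[distribution P Xpair]_p f p)%E; last first.
  by rewrite ge0_integral_distribution.
by apply: eq_measure_integral => S mS _; exact: joint_law.
Qed.

Definition D_mean (h : n.-tuple A -> R) (w : Omega) : R := \int[power_prob (D w) n]_y h y.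

Lemma measurable_D_mean h : measurable_fun setT h ->
  measurable_fun setT (D_mean h).
Proof.
move=> mh; apply: measurableT_comp => //.
under eq_fun do rewrite integralE.
have mEh : measurable_fun setT (EFin \o h) by exact/measurable_EFinP.
have mP := measurable_power_prob (n := n) D_meas.
have mint (f : n.-tuple A -> \bar R) : measurable_fun setT f -> (forall y, 0 <= f y)%E ->
    measurable_fun setT (fun w => \int[power_prob (D w) n]_y f y)%E.
  by move=> mf f0; exact: (measurableT_comp (measurable_giry_int mf f0) mP).
by apply: emeasurable_funB; apply: mint => //;
  [exact: measurable_funepos|exact: measurable_funeneg].
Qed.

(** The extended integral of p against the power of D has the mean of p at n observations as its
    expectation, hence is almost surely finite. This first conclusion is kept because [D_mean]
    applies [fine], so that recombining positive and negative parts requires finite values. *)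
Lemma D_mean_ge0 (B : set (k.-tuple A)) (p : n.-tuple A -> R) :
  measurable B -> measurable_fun setT p ->
  (forall y, 0 <= p y) -> P.-integrable setT (EFin \o (p \o Xat (iota_tuple n k))) ->
  [/\ {ae P, forall w, (\int[power_prob (D w) n]_y (p y)%:E \is a fin_num)%E},
      P.-integrable setT (EFin \o D_mean p) &
      \int[P]_w (\1_B (Xvec X k w) * D_mean p w) =
      \int[P]_w (\1_B (Xvec X k w) * p (Xat (iota_tuple n k) w))].
Proof.
move=> mB mp p0 intp.
have mEp : measurable_fun setT (EFin \o p) by exact/measurable_EFinP.
have G0 w : (0 <= \int[power_prob (D w) n]_y (p y)%:E)%E.
  by apply: integral_ge0 => y _; rewrite lee_fin.
have mG : measurable_fun setT (fun w => \int[power_prob (D w) n]_y (p y)%:E)%E.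
  exact: (measurableT_comp (measurable_giry_int mEp p0) (measurable_power_prob (n := n) D_meas)).
have H (S : set (k.-tuple A)) : measurable S ->
  (\int[P]_w ((\1_S (Xvec X k w))%:E * \int[power_prob (D w) n]_y (p y)%:E) =
   \int[P]_w (\1_S (Xvec X k w) * p (Xat (iota_tuple n k) w))%:E)%E.
  move=> mS.
  rewrite -(@integral_joint (fun q => (\1_S q.1 * p q.2)%:E)); last 2 first.
  - apply/measurable_EFinP; apply: measurable_funM; exact: measurableT_comp.
  - by move=> q; rewrite lee_fin mulr_ge0.
  apply: eq_integral => w _ /=; rewrite -ge0_integralZl//.
  by move=> y _; rewrite lee_fin.
have intG : P.-integrable setT (fun w => \int[power_prob (D w) n]_y (p y)%:E)%E.
  apply/integrableP; split => //.
  under eq_integral do rewrite gee0_abs//.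
  have -> : (\int[P]_w \int[power_prob (D w) n]_y (p y)%:E =
    \int[P]_w (p (Xat (iota_tuple n k) w))%:E)%E.
    transitivity (\int[P]_w ((\1_[set: k.-tuple A] (Xvec X k w))%:E *
      \int[power_prob (D w) n]_y (p y)%:E))%E.
      by apply: eq_integral => w _; rewrite indicT mul1e.
    by rewrite H//; apply: eq_integral => w _; rewrite indicT mul1r.
  rewrite -ge0_fin_numE; first exact: integrable_fin_num intp.
  by apply: integral_ge0 => w _; rewrite lee_fin.
have aefin := integrable_ae measurableT intG.
have aeE : ae_eq P setT (fun w => \int[power_prob (D w) n]_y (p y)%:E)%E (EFin \o D_mean p).
  by apply: filterS aefin => w /(_ I) fw _; rewrite /= fineK.
have mDp := measurable_D_mean mp.
split.
- by apply: filterS aefin => w /(_ I).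
- apply: (le_integrable _ _ _ intG) => //; first exact/measurable_EFinP.
  move=> w _; rewrite /= /D_mean /Rintegral.
  by case: (integral _ _ _) => [r| |] /=; rewrite ?normr0 ?leey.
rewrite /Rintegral -H//; congr fine; apply/esym; apply: ae_eq_integral => //.
- apply: emeasurable_funM => //; apply/measurable_EFinP.
  by apply: measurableT_comp => //; exact: measurable_Xvec.
- apply/measurable_EFinP; apply: measurable_funM => //.
  by apply: measurableT_comp => //; exact: measurable_Xvec.
by apply: filterS aeE => w /(_ I) /= -> _.
Qed.

Lemma D_mean_integral (B : set (k.-tuple A)) (h : n.-tuple A -> R) :
  measurable B -> measurable_fun setT h ->
  P.-integrable setT (EFin \o (h \o Xat (iota_tuple n k))) ->
  P.-integrable setT (EFin \o D_mean h) /\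
  \int[P]_w (\1_B (Xvec X k w) * D_mean h w) =
  \int[P]_w (\1_B (Xvec X k w) * h (Xat (iota_tuple n k) w)).
Proof.
move=> mB mh inth.
have [finp intp Ep] := D_mean_ge0 mB (measurable_funrpos mh) (funrpos_ge0 h)
  (integrable_funrpos measurableT inth).
have [finn intn En] := D_mean_ge0 mB (measurable_funrneg mh) (funrneg_ge0 h)
  (integrable_funrneg measurableT inth).
have aeE : {ae P, forall w, D_mean h^\+ w - D_mean h^\- w = D_mean h w}.
  apply: filterS2 finp finn => w fp fn.
  rewrite /D_mean /Rintegral [in RHS]integralE -fineB//; congr fine.
  by congr (_ - _)%E; apply: eq_integral => y _;
    rewrite ?funeposE ?funenegE /= ?/funrpos ?/funrneg EFin_max.
have mXB : measurable (Xvec X k @^-1` B).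
  by rewrite -[X in measurable X]setTI; exact: measurable_Xvec.
have intB : P.-integrable setT (EFin \o (fun w =>
  D_mean h^\+ w - D_mean h^\- w)) by exact: (integrableB _ intp intn).
have [intD _] := ae_eq_Rintegral (measurable_D_mean mh) intB aeE.
split=> //.
have mI := @integrable_indicM _ _ _ P _ _ mXB.
have aeE' : {ae P, forall w, \1_B (Xvec X k w) * D_mean h^\+ w - \1_B (Xvec X k w) *
  D_mean h^\- w = \1_B (Xvec X k w) * D_mean h w}.
  by apply: filterS aeE => w <-; rewrite mulrBr.
have intB' := integrableB measurableT (mI _ intp) (mI _ intn).
have mID : measurable_fun setT (fun w => \1_B (Xvec X k w) * D_mean h w).
  by have /measurable_EFinP := measurable_int _ (mI _ intD).
have [_ <-] := ae_eq_Rintegral mID intB' aeE'.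
rewrite (RintegralB measurableT (mI _ intp) (mI _ intn)) Ep En.
rewrite -RintegralB//.
- by apply: eq_Rintegral => w _; rewrite -mulrBr -[in RHS](funrposBneg h).
- by apply: (mI (h^\+ \o Xat (iota_tuple n k))); exact: (integrable_funrpos measurableT inth).
- by apply: (mI (h^\- \o Xat (iota_tuple n k))); exact: (integrable_funrneg measurableT inth).
Qed.

End joint_law.

(** * Projections on the past *)

Section projections.
Variables (F : Omega -> R) (h : forall n, n.-tuple A -> R).
Hypothesis F_L2 : F \in Lfun P 2%:E.
Hypothesis h_Xi : forall n, (1 <= n)%N -> Xi P X (@h n).
Hypothesis F_dec : hoeffding_decomposition P D F h.

(* [projection k] is a version of E(F - E(F) | X_1, ..., X_k). *)
Definition projection (k : nat) (x : seq A) : R :=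
  \sum_(1 <= n < k.+1) n`!%:R / rising (c + k%:R) n * \sum_(b <- subseqs n x) on_seq (@h n) b.

Let integrable_h n : (1 <= n)%N -> forall k,
  P.-integrable setT (EFin \o (@h n \o Xat (iota_tuple n k))).
Proof.
case: n => // n _ k.
rewrite (_ : _ \o _ = (fun w => on_seq (@h n.+1) (Xseq (iota k n.+1) w))).
  by apply: Xi_integrable_on_seq; [exact: h_Xi|exact: iota_uniq|rewrite size_iota].
by apply/funext => w; rewrite /= -on_seq_tuple -Xseq_Xat.
Qed.

Let mh n : (1 <= n)%N -> measurable_fun setT (@h n).
Proof. by move=> /h_Xi[]. Qed.

Let integrable_D_mean n : (1 <= n)%N -> P.-integrable setT (EFin \o D_mean (@h n)).
Proof.
move=> n1.
by have [] := D_mean_integral (k := 0) (measurableT : measurable [set: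
  0.-tuple A]) (mh n1) (integrable_h n1 0).
Qed.

Let integrable_F : P.-integrable setT (EFin \o F).
Proof.
apply/Lfun1_integrable; apply: Lfun_subset12 => //.
by rewrite fin_num_measure.
Qed.

(** Averaging against the power of D amounts to evaluating the kernel at the n observations that
    follow time k; [future_block_integral] brings this block back into the past. *)
Lemma D_mean_past k (B : set (k.-tuple A)) n : (1 <= n)%N -> measurable B ->
  \int[P]_w (\1_B (Xvec X k w) * D_mean (@h n) w) =
  n`!%:R / rising (c + k%:R) n *
  \sum_(L <- subseqs n (iota 0 k)) \int[P]_w (\1_B (Xvec X k w) * on_seq (@h n) (Xseq L w)).
Proof.
case: n => // q n1 mB.
rewrite -(future_block_integral (h_Xi n1) mB).
have [_ ->] := D_mean_integral mB (mh n1) (integrable_h n1 k).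
by apply: eq_Rintegral => w _; congr (_ * _); rewrite -on_seq_tuple -Xseq_Xat.
Qed.

Lemma Xvec_Xseq k w : Xvec X k w = Xseq (iota 0 k) w :> seq A.
Proof. by rewrite XvecE -Xseq_Xat. Qed.

Lemma integrable_on_seq_subseqs k n L : (1 <= n)%N -> L \in subseqs n (iota 0 k) ->
  P.-integrable setT (EFin \o (fun w => on_seq (@h n) (Xseq L w))).
Proof.
case: n => // q n1; rewrite mem_subseqs => /andP[Lk /eqP sL].
apply: Xi_integrable_on_seq => //; first exact: h_Xi.
exact: (subseq_uniq Lk (iota_uniq _ _)).
Qed.

Lemma projection_integral k (B : set (k.-tuple A)) : measurable B ->
  P.-integrable setT (EFin \o (fun w => projection k (Xvec X k w))) /\
  \int[P]_w (\1_B (Xvec X k w) * projection k (Xvec X k w)) =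
  \sum_(1 <= n < k.+1) \int[P]_w (\1_B (Xvec X k w) * D_mean (@h n) w).
Proof.
move=> mB.
have mXB : measurable (Xvec X k @^-1` B).
  by rewrite -[X in measurable X]setTI; exact: measurable_Xvec.
pose Q n w : R := \sum_(L <- subseqs n (iota 0 k)) on_seq (@h n) (Xseq L w).
have QE n w : \sum_(b <- subseqs n (Xvec X k w)) on_seq (@h n) b = Q n w.
  by rewrite Xvec_Xseq sum_subseqs_map.
have projE w : projection k (Xvec X k w) =
  \sum_(1 <= n < k.+1) n`!%:R / rising (c + k%:R) n * Q n w.
  by apply: eq_bigr => n _; rewrite QE.
have intQ n : (1 <= n)%N -> P.-integrable setT (EFin \o Q n).
  move=> n1; apply: (Rintegral_sum (F := fun L w => on_seq (@h n) (Xseq L w)) _).1 => L Ln _.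
  exact: integrable_on_seq_subseqs Ln.
have intcQ n : n \in index_iota 1 k.+1 -> true -> P.-integrable setT (EFin \o (fun w =>
  n`!%:R / rising (c + k%:R) n * Q n w)).
  by rewrite mem_index_iota => /andP[n1 _] _; exact: (integrableZl _ _ (intQ n n1)).
have intP : P.-integrable setT (EFin \o (fun w => projection k (Xvec X k w))).
  under eq_fun do rewrite projE.
  exact: (Rintegral_sum intcQ).1.
split=> //.
transitivity (\int[P]_w (\sum_(1 <= n < k.+1) \1_B (Xvec X k w) * (n`!%:R / rising (c +
  k%:R) n * Q n w))).
  by apply: eq_Rintegral => w _; rewrite projE mulr_sumr.
rewrite (Rintegral_sum (F := fun n w => \1_B (Xvec X k w) * (n`!%:R / rising (c +
  k%:R) n * Q n w)) _).2; last first.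
  by move=> n ni _; apply: (integrable_indicM mXB); exact: intcQ.
apply: eq_big_nat => n /andP[n1 _]; rewrite D_mean_past//.
transitivity (\int[P]_w (n`!%:R / rising (c + k%:R) n * (\1_B (Xvec X k w) * Q n w))).
  by apply: eq_Rintegral => w _; rewrite mulrCA.
rewrite RintegralZl//; last by apply: (integrable_indicM mXB); exact: intQ.
congr (_ * _).
rewrite -(Rintegral_sum (F := fun L w => \1_B (Xvec X k w) * on_seq (@h n) (Xseq L w)) _).2;
  last first.
  by move=> L Ln _; apply: (integrable_indicM mXB); exact: integrable_on_seq_subseqs Ln.
by apply: eq_Rintegral => w _; rewrite mulr_sumr.
Qed.

(** Terms with n > k integrate to zero over {X^k in B}. Thus the discrepancy v of the two sides is
    the integral of the N-th remainder over this event for every N >= k, and is bounded by an L^2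
    norm that tends to zero. *)
Lemma centered_past_integral k (B : set (k.-tuple A)) : measurable B ->
  \int[P]_w (\1_B (Xvec X k w) * (F w - fine 'E_P[F])) =
  \sum_(1 <= n < k.+1) \int[P]_w (\1_B (Xvec X k w) * D_mean (@h n) w).
Proof.
move=> mB.
have mXB : measurable (Xvec X k @^-1` B).
  by rewrite -[X in measurable X]setTI; exact: measurable_Xvec.
pose m := fine 'E_P[F].
pose rest N w := F w - (m + \sum_(1 <= n < N.+1) D_mean (@h n) w).
have sumD N : P.-integrable setT (EFin \o (fun w => \sum_(1 <= n < N.+1) D_mean (@h n) w)).
  apply: (Rintegral_sum (F := fun n w => D_mean (@h n) w) _).1 => n.
  by rewrite mem_index_iota => /andP[n1 _] _; exact: integrable_D_mean.
have intFm : P.-integrable setT (EFin \o (fun w => F w - m)).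
  have intm : P.-integrable setT (EFin \o cst m) by exact: finite_measure_integrable_cst.
  exact: (integrableB _ integrable_F intm).
have restE N w : rest N w = (F w - m) - \sum_(1 <= n < N.+1) D_mean (@h n) w.
  by rewrite /rest opprD addrA.
have int_rest N : P.-integrable setT (EFin \o rest N).
  rewrite (_ : rest N = fun w => (F w - m) - \sum_(1 <= n < N.+1) D_mean (@h n) w);
    last exact/funext.
  exact: (integrableB _ intFm (sumD N)).
have vanish n : (k < n)%N -> \int[P]_w (\1_B (Xvec X k w) * D_mean (@h n) w) = 0.
  move=> kn; rewrite D_mean_past//; last exact: leq_ltn_trans kn.
  by rewrite subseqs_eq0 ?big_nil ?mulr0// size_iota.
pose v := \int[P]_w (\1_B (Xvec X k w) * (F w - m)) -
  \sum_(1 <= n < k.+1) \int[P]_w (\1_B (Xvec X k w) * D_mean (@h n) w).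
have vE N : (k <= N)%N -> \int[P]_w (\1_B (Xvec X k w) * rest N w) = v.
  move=> kN.
  transitivity (\int[P]_w (\1_B (Xvec X k w) * (F w - m) - \1_B (Xvec X k w) *
    \sum_(1 <= n < N.+1) D_mean (@h n) w)).
    by apply: eq_Rintegral => w _; rewrite restE mulrBr.
  rewrite RintegralB//; [|exact: (integrable_indicM mXB)|exact: (integrable_indicM mXB)].
  congr (_ - _).
  transitivity (\int[P]_w (\sum_(1 <= n < N.+1) \1_B (Xvec X k w) * D_mean (@h n) w)).
    by apply: eq_Rintegral => w _; rewrite mulr_sumr.
  rewrite (Rintegral_sum (F := fun n w => \1_B (Xvec X k w) * D_mean (@h n) w) _).2; last first.
    move=> n; rewrite mem_index_iota => /andP[n1 _] _.
    by apply: (integrable_indicM mXB); exact: integrable_D_mean.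
  rewrite (big_cat_nat (n := k.+1))//= [X in _ + X]big_nat [X in _ + X]big1 ?addr0//.
  by move=> n /andP[kn _]; exact: vanish.
have v_le N : (k <= N)%N -> (`|v|%:E <= 'N[P]_(2%:E)[EFin \o rest N])%E.
  move=> kN; rewrite -(vE N kN); apply: le_Rintegral_Lnorm2 mXB _; exact: int_rest.
apply/eqP; rewrite -subr_eq0 -normr_le0 -lee_fin.
have rest_cvg : ('N[P]_(2%:E)[EFin \o rest N] @[N --> \oo] --> 0)%E by exact: F_dec.
apply: (cvge_ge _ rest_cvg).
by exists k => // N /= kN; exact: v_le.
Qed.

Lemma measurable_projection k : measurable_fun setT (fun x : k.-tuple A => projection k x).
Proof.
(* Sums over index lists, fixed as x varies, replace sums over subsequences of x. The guard on n is
   there because every summand has to be measurable, also for n = 0, where no assumption is made on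
   [h]. *)
rewrite (_ : (fun _ => _) = (fun x : k.-tuple A => \sum_(n <- index_iota 1 k.+1)
    n`!%:R / rising (c + k%:R) n * \sum_(L <- subseqs n (iota 0 k))
      (if (1 <= n)%N then on_seq (@h n) [seq nth point x i | i <- L] else 0))); last first.
  apply/funext => x; rewrite /projection; apply: eq_big_nat => n /andP[-> _]; congr (_ * _).
  rewrite -sum_subseqs_map; congr (\sum_(b <- subseqs n _) _).
  by rewrite -{1}(mkseq_nth point x) size_tuple.
apply: measurable_sum => n; apply: measurable_funM => //; apply: measurable_sum => L.
case: (ltnP 0 n) => [n1|_]; last exact: measurable_cst.
rewrite (_ : (fun _ => _) = @h n \o (fun x : k.-tuple A =>
  [tuple nth point [seq nth point x i | i <- L] j | j < n])).
  apply: measurableT_comp; first exact: mh.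
  apply/measurable_fun_tnthP => j.
  rewrite (_ : _ \o _ = fun x : k.-tuple A => nth point [seq nth point x i | i <- L] j); last first.
    by apply/funext => x; rewrite /= tnth_mktuple.
  have [jL|Lj] := ltnP j (size L).
    rewrite (_ : (fun _ => _) = (fun x : k.-tuple A => nth point x (nth 0%N L j))).
      exact: measurable_nth_tuple.
    by apply/funext => x; rewrite (nth_map 0%N).
  rewrite (_ : (fun _ => _) = cst point)//.
  by apply/funext => x; rewrite nth_default// size_map.
by [].
Qed.

(** * Recovering the kernels from the conditional expectations *)

Variable g : forall k, k.-tuple A -> R.
Hypothesis g_cond : forall k, (1 <= k)%N ->
  cond_exp_version P (fun w => F w - fine 'E_P[F]) (Xvec X k) (@g k).

(** Both functions have the integrals of F - E(F) over all events {X^k in S}. *)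
Lemma cond_exp_projection k : (1 <= k)%N ->
  {ae distribution P (Xvec X k), forall x, g x = projection k x}.
Proof.
move=> k1; have [mg intg gE] := g_cond k1.
have intp := (projection_integral (measurableT : measurable [set: k.-tuple A])).1.
have mp := (@measurable_projection k).
suff : {ae distribution P (Xvec X k), forall x, g x - projection k x = 0}.
  by apply: filterS => x /eqP; rewrite subr_eq0 => /eqP.
apply: distribution_ae_eq0.
- exact: measurable_funB.
- exact: (integrableB measurableT intg intp).
move=> S mS.
have mXS : measurable (Xvec X k @^-1` S).
  by rewrite -[X in measurable X]setTI; exact: measurable_Xvec.
transitivity (\int[P]_w (\1_S (Xvec X k w) * g (Xvec X k w) - \1_S (Xvec X k w) *
  projection k (Xvec X k w))).
  by apply: eq_Rintegral => w _; rewrite mulrBr.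
have H1 := integrable_indicM mXS intg.
have H2 := integrable_indicM mXS intp.
rewrite (RintegralB measurableT H1 H2).
rewrite (projection_integral mS).2 -centered_past_integral//.
apply/eqP; rewrite subr_eq0; apply/eqP.
have := gE S mS => /(congr1 fine).
by rewrite -(Rintegral_indic P (@g k \o Xvec X k) mXS) -(Rintegral_indic P (fun w =>
  F w - fine 'E_P[F]) mXS).
Qed.

(** The theorem evaluates g at some of the n coordinates, so an exceptional set that is null for a
    shorter vector has to pull back to a null set for X^n. The coordinates of X^n at the increasing
    positions L have the law of the first [size L] observations. *)
Lemma cond_exp_projection_subseq n L : (1 <= size L)%N -> subseq L (iota 0 n) ->
  {ae distribution P (Xvec X n), forall a : n.-tuple A,
    on_seq (@g (size L)) [seq nth point a i | i <- L] =
      projection (size L) [seq nth point a i | i <- L]}.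
Proof.
move=> L1 Ln.
pose pi (a : n.-tuple A) : (size L).-tuple A := [tuple nth point a (nth 0%N L i) | i < size L].
have piE (a : n.-tuple A) : [seq nth point a i | i <- L] = pi a :> seq A.
  apply: (@eq_from_nth _ point); first by rewrite size_map size_tuple.
  move=> i; rewrite size_map => iL.
  by rewrite (nth_map 0%N)// -[i]/(val (Ordinal iL)) -tnth_nth tnth_mktuple.
have sL : sorted ltn L := subseq_sorted ltn_trans Ln (iota_ltn_sorted 0 n).
have piX w : pi (Xvec X n w) = Xat (in_tuple L) w.
  apply: val_inj; rewrite -[LHS]piE -[RHS]Xseq_Xat /=; apply/eq_in_map => i /(mem_subseq Ln).
  rewrite mem_iota /= add0n => i_n.
  by rewrite (nth_map (Ordinal i_n)) ?size_enum_ord// nth_enum_ord.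
have mpi : measurable_fun setT pi by exact: measurable_select.
have [N [mN N0 NP]] := cond_exp_projection L1.
exists (pi @^-1` N); split.
- by rewrite -[X in measurable X]setTI; exact: mpi.
- rewrite -[RHS]N0 -[RHS](polya_law (s := in_tuple L))//.
  by congr (P _); apply/funext => w /=; rewrite piX.
move=> a /= aP; apply: NP => /= gP; apply: aP.
by rewrite piE on_seq_tuple.
Qed.

Lemma sum_on_seq_subseqs k n (a : n.-tuple A) :
  \sum_(j : k.-tuple 'I_n | sorted (fun i i' : 'I_n =>
    (i < i')%N) j) g [tuple tnth a (tnth j l) | l < k] =
  \sum_(b <- subseqs k a) on_seq (@g k) b.
Proof.
rewrite -[in RHS](map_tnth_enum a) sum_subseqs_map -(sum_sorted_tuples k (fun j =>
  on_seq (@g k) [seq tnth a i | i <- j])).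
apply: eq_bigr => j _; rewrite -on_seq_tuple; congr on_seq.
by rewrite -[in RHS](map_tnth_enum j) -map_comp [LHS]/=.
Qed.

(** A pointwise identity without probability: after double counting, the coefficient of the sum of h
    m over the subsequences of length m is the sum in [theta_limit_inversion], and only the full
    sequence remains. *)
Lemma projection_inversion n (a : n.-tuple A) : (1 <= n)%N ->
  \sum_(1 <= k < n.+1) theta c n k * \sum_(b <- subseqs k a) projection k b = h a.
Proof.
move=> n1.
pose H m := \sum_(r <- subseqs m a) on_seq (@h m) r.
pose q k m : R := m`!%:R / rising (c + k%:R) m * 'C(n - m, k - m)%:R.
transitivity (\sum_(1 <= k < n.+1) \sum_(1 <= m < n.+1 | (m <= k)%N) theta_limit c n k * q k m *
  H m).
  apply: eq_big_nat => k /andP[k1 kn]; rewrite theta_limitE ?k1//.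
  rewrite exchange_big/= mulr_sumr (big_nat_widen 1 k.+1 n.+1)//=.
  apply: eq_big => // m mk.
  by rewrite -mulr_sumr sum_subseqs_subseqs// size_tuple !mulrA.
rewrite (exchange_big_dep_nat xpredT)//=.
transitivity (\sum_(1 <= m < n.+1) (m == n)%:R * H m).
  apply: eq_big_nat => m /andP[m1 mn].
  rewrite -(theta_limit_inversion alpha_gt0); last by rewrite m1.
  rewrite mulr_suml [in RHS](big_nat_widenl _ 1)//=.
  by apply: eq_bigr => k _; rewrite !mulrA.
rewrite big_nat_recr//= eqxx mul1r big_nat big1 ?add0r.
  by rewrite /H -[X in subseqs X]/n -{1}(size_tuple a) subseqs_full big_seq1 on_seq_tuple.
by move=> m /andP[_ mn]; rewrite ltn_eqF// mul0r.
Qed.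

Lemma cond_exp_inversion n : (1 <= n)%N ->
  {ae distribution P (Xvec X n), forall a : n.-tuple A,
    h a = \sum_(1 <= k < n.+1) theta c n k *
      \sum_(j : k.-tuple 'I_n | sorted (fun i i' : 'I_n => (i < i')%N) j)
        g [tuple tnth a (tnth j l) | l < k]}.
Proof.
move=> n1.
pose Q L (a : n.-tuple A) := on_seq (@g (size L)) [seq nth point a i | i <- L] =
  projection (size L) [seq nth point a i | i <- L].
(* The index lists in question are finitely many, so one null set serves them all. *)
have aeQ : {ae distribution P (Xvec X n), forall a L,
    L \in flatten [seq subseqs k (iota 0 n) | k <- iota 1 n] -> Q L a}.
  apply: ae_all_seq => L /flatten_mapP[k]; rewrite mem_iota mem_subseqs.
  move=> /andP[k1 _] /andP[Ln /eqP Lk]; apply: cond_exp_projection_subseq => //.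
  by rewrite Lk.
apply: filterS aeQ => a aQ.
rewrite -(projection_inversion a n1); apply: eq_big_nat => k /andP[k1 kn].
rewrite sum_on_seq_subseqs; congr (_ * _).
have aE : a = [seq nth point a i | i <- iota 0 n] :> seq A.
  by rewrite -[LHS](mkseq_nth point) size_tuple.
rewrite [in LHS]aE [in RHS]aE !sum_subseqs_map big_seq [RHS]big_seq.
apply: eq_bigr => L Lk; have : Q L a.
  apply: aQ; apply/flatten_mapP; exists k => //.
  by rewrite mem_iota k1 add1n.
have /eqP <- : size L == k by move: Lk; rewrite mem_subseqs => /andP[].
by move=> ->.
Qed.

End projections.

End directing_measure.

End polya.

Theorem theorem2 (R : realType) (A : ptopologicalType) (hA : polish R A)
    (alpha : {finite_measure set (borel A) -> \bar R})
    (alpha_gt0 : (0 < alpha [set: borel A])%E)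
    (dO : measure_display) (Omega : measurableType dO) (P : probability Omega R)
    (X : nat -> {mfun Omega >-> borel A})
    (D : Omega -> probability (borel A) R)
    (X_polya : polya_sequence P alpha X)
    (D_DF : dirichlet_ferguson P alpha D)
    (D_lim : empirical_limit P X D)
    (F : Omega -> R) (F_L2D : L2D P D F)
    (h : forall n : nat, n.-tuple (borel A) -> R)
    (h_Xi : forall n : nat, (1 <= n)%N -> Xi P X (h n))
    (F_dec : hoeffding_decomposition P D F h)
    (g : forall k : nat, k.-tuple (borel A) -> R)
    (g_cond : forall k : nat, (1 <= k)%N ->
       cond_exp_version P (fun w => F w - fine ('E_P[F])%E) (Xvec X k) (g k)) :
  forall n : nat, (1 <= n)%N ->
    {ae distribution P (Xvec X n), forall a : n.-tuple (borel A),
      h n a =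
      \sum_(1 <= k < n.+1) theta (fine (alpha [set: borel A])) n k *
        \sum_(j : k.-tuple 'I_n | sorted (fun i i' : 'I_n => (i < i')%N) j)
          g k [tuple tnth a (tnth j l) | l < k]}.

Proof.
have c0 : 0 < fine (alpha [set: borel A]).
  by rewrite fine_gt0// alpha_gt0/= ltey_eq fin_num_measure.
move=> n n1.
exact: (cond_exp_inversion c0 X_polya D_DF.1 D_lim F_L2D.1 h_Xi F_dec g_cond n1).
Qed.
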